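(* Let $Q\in\mathcal B$ and $0<\alpha<1$. Suppose there exists $0<\alpha_0<\alpha$ such that $\mathcal D^{\alpha_0,\alpha}_1(Q)>-\infty$. Then the function $(0,1)\ni x\mapsto\mathcal H_x(\Lambda,\phi_0)(Q)$ is left differentiable at $\alpha$, and $$\left.\frac{d_-}{d_-x}\mathcal H_x(\Lambda,\phi_0)(Q)\right|_{x=\alpha}=\mathcal E^{\alpha,\alpha}_1(Q)=\lim_{x\to\alpha,\ x<\alpha}\mathcal E^{\alpha,x}_1(Q),$$ where $d_-/d_-x$ denotes the left derivative.
   Context: Setting. Let $X$ be a set, $S:X\to X$ a bijection, $\mathcal A$ a $\sigma$-algebra on $X$, $\mathcal A_0$ the $\sigma$-algebra generated by $\bigcup_{i\ge 0}S^{-i}\mathcal A$, $\mathcal B$ the $\sigma$-algebra generated by $\bigcup_{i\in\mathbb Z}S^{-i}\mathcal A$, and $\mathcal A_m:=S^{-m}\mathcal A_0=\{S^{-m}A:A\in\mathcal A_0\}$ for integers $m\le 0$ (so $\mathcal A_0\subset\mathcal A_{-1}\subset\cdots$). Let $\phi_0$ be a finite positive measure on $\mathcal A_0$, and $\Lambda$ a finite positive measure on $\mathcal A_0$ with $\Lambda\circ S^{-1}=\Lambda$ and $\Lambda\ll\phi_0$; let $Z\ge0$ be an $\mathcal A_0$-measurable version of $d\Lambda/d\phi_0$. For $Q\subset X$ let $\mathcal C(Q)$ be the set of all sequences $(A_m)_{m\le0}$ with $A_m\in\mathcal A_m$ for all $m\le 0$ and $Q\subset\bigcup_{m\le0}A_m$.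 The symbol $\Lambda$ also denotes $\Lambda(Q):=\inf_{(A_m)\in\mathcal C(Q)}\sum_{m\le0}\Lambda(S^mA_m)$, $Q\subset X$; its restriction to $\mathcal B$ is the unique $S$-invariant measure on $\mathcal B$ extending $\Lambda$. Conventions: extended real numbers are used, $0\log0:=0$, $y^x:=e^{x\log y}$ and thus $0^0:=1$; $Z^\alpha\log Z:=0$ where $Z=0$ ($\alpha>0$). For $\alpha\ge0$ and $Q\subset X$: $\mathcal H_\alpha(\Lambda,\phi_0)(Q):=\inf_{(A_m)\in\mathcal C(Q)}\sum_{m\le0}\int_{S^mA_m}Z^\alpha d\phi_0$. For $\epsilon>0$ and $0\le\beta\le1$: $\mathcal C^1_\epsilon(Q):=\{(A_m)\in\mathcal C(Q):\sum_{m\le0}\Lambda(S^mA_m)<\Lambda(Q)+\epsilon\}$; $\mathcal H^{\beta,1}(\Lambda,\phi_0)(Q):=\lim_{\epsilon\to0}\inf_{(A_m)\in\mathcal C^1_\epsilon(Q)}\sum_{m\le0}\int_{S^mA_m}Z^\beta d\phi_0$; $\mathcal C^{\beta,1}_\epsilon(Q):=\{(A_m)\in\mathcal C^1_\epsilon(Q):\sum_{m\le0}\int_{S^mA_m}Z^\beta d\phi_0<\mathcal H^{\beta,1}(\Lambda,\phi_0)(Q)+\epsilon\}$. For $0<\alpha\le1$ and $0\le\beta\le1$: $\mathcal D^{\alpha,\beta}_1(Q):=\lim_{\epsilon\to0}\inf_{(A_m)\in\mathcal C^{\beta,1}_\epsilon(Q)}\sum_{m\le0}\int_{S^mA_m}Z^\alpha\log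 Z\,d\phi_0$ and $\mathcal E^{\alpha,\beta}_1(Q):=\lim_{\epsilon\to0}\sup_{(A_m)\in\mathcal C^{\beta,1}_\epsilon(Q)}\sum_{m\le0}\int_{S^mA_m}Z^\alpha\log Z\,d\phi_0$. *)

(* Defs.v *)
From HB Require Import structures.
From mathcomp Require Import all_boot all_order all_algebra.
From mathcomp Require Import all_classical all_reals all_analysis measurable_realfun.

Set Implicit Arguments.
Unset Strict Implicit.
Unset Printing Implicit Defensive.

Import Order.TTheory GRing.Theory Num.Theory.
Import numFieldNormedType.Exports.

Local Open Scope classical_set_scope.
Local Open Scope ring_scope.

Section shift_sigma_algebras.
Context d (X : measurableType d) (S : X -> X).

(* The union of the S^{-i} A over i >= 0, where A is the given sigma-algebra
   of X. *)
Definition forward_sets : set (set X) :=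
  \bigcup_(i : nat) [set iter i S @^-1` A | A in measurable].

(* The sets S^{-i} A for i < 0 are the direct images under the iterates of S
   (S is meant to be bijective). *)
Definition two_sided_sets : set (set X) :=
  forward_sets `|` \bigcup_(i : nat) [set iter i S @` A | A in measurable].

End shift_sigma_algebras.

(* X equipped with A_0. *)
Notation forward_type S := (g_sigma_algebraType (forward_sets S)).

(* Integer indices m <= 0 are encoded by n = - m : nat throughout. *)
Section covers.
Context d (X : measurableType d) (S : X -> X).
Implicit Types (n : nat) (Q : set X) (A : nat -> set X).

(* A_m = S^{-m} A_0 for m = - n *)
Definition past_algebra n : set (set X) :=
  [set iter n S @` B | B in <<s forward_sets S >>].

Definition covers Q : set (nat -> set X) :=
  [set A | (forall n, past_algebra n (A n)) /\ Q `<=` \bigcup_n A n].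

(* S^m A_m for m = - n *)
Definition pullback A n : set (forward_type S) := iter n S @^-1` A n.

End covers.
Arguments pullback {d X} S A n.

Section hellinger.
Context {R : realType} d (X : measurableType d) (S : X -> X).
Variables Lambda phi0 : {finite_measure set (forward_type S) -> \bar R}.
Variable Z : forward_type S -> \bar R.
Implicit Types (Q : set X) (A : nat -> set X) (alpha beta eps : R).

Local Open Scope ereal_scope.

Definition measure_sum A : \bar R :=
  \sum_(0 <= n <oo) Lambda (pullback S A n).

Definition Lambda_outer Q : \bar R :=
  ereal_inf [set measure_sum A | A in covers S Q].

Definition power_sum alpha A : \bar R :=
  \sum_(0 <= n <oo) \int[phi0]_(z in pullback S A n) (Z z `^ alpha).

(* For alpha > 0 the integrand is 0 where Z = 0, since 0 `^ alpha = 0 and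
   0 * -oo = 0. The terms of the series have no constant sign: its value is the
   limit of the partial sums. *)
Definition power_log_sum alpha A : \bar R :=
  \sum_(0 <= n <oo)
    \int[phi0]_(z in pullback S A n) (Z z `^ alpha * lne (Z z)).

Definition H alpha Q : \bar R :=
  ereal_inf [set power_sum alpha A | A in covers S Q].

Definition covers1 eps Q : set (nat -> set X) :=
  covers S Q `&` [set A | measure_sum A < Lambda_outer Q + eps%:E].

Definition H1 beta Q : \bar R :=
  lim (ereal_inf [set power_sum beta A | A in covers1 eps Q]
       @[eps --> (0 : R)^'+]).

Definition coversH1 beta eps Q : set (nat -> set X) :=
  covers1 eps Q `&` [set A | power_sum beta A < H1 beta Q + eps%:E].

Definition D1 alpha beta Q : \bar R :=
  lim (ereal_inf [set power_log_sum alpha A | A in coversH1 beta eps Q]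
       @[eps --> (0 : R)^'+]).

Definition E1 alpha beta Q : \bar R :=
  lim (ereal_sup [set power_log_sum alpha A | A in coversH1 beta eps Q]
       @[eps --> (0 : R)^'+]).

End hellinger.

(* f has the finite left derivative l at a. With the conventions of \bar R for
   +oo - +oo, convergence to a finite l forces f to be finite at a and on a left
   neighbourhood of a. *)
Definition is_left_derivative {R : realType} (f : R -> \bar R) (a l : R) :=
  ((f x - f a) * ((x - a)^-1)%:E)%E @[x --> a^'-] --> l%:E.

(* Main.v *)
(* For a cover A put h_A(x) = sum over n of the integrals of Z^x over S^{-n}(A_n),
   so that x |-> H_x(Q) is the infimum of the convex functions h_A, and let
   L_A(x) = h_A'(x) be the corresponding sum for Z^x log Z.

   Covers that are almost optimal for Lambda and for Z^x simultaneously exist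
   (common_cover), so the restricted infimum in H^{x,1} is H_x itself.

   If A is almost optimal for Z^alpha, then for x < alpha
     H_x <= h_A(x) <= h_A(alpha) - (alpha - x) L_A(alpha) + K (alpha - x)^2
   with K uniform in A: for Z >= 1 the second derivative of Z^x is bounded by a
   multiple of Z, and for Z < 1 by a multiple of Z^alpha0 |log Z|, whose sum is
   controlled by the lower bound on D^{alpha0,alpha}. If A is almost optimal for
   Z^x, then H_alpha <= h_A(alpha) <= h_A(x) + (alpha - x) L_A(alpha), and A is
   still almost optimal for Z^alpha up to O(alpha - x). Hence the slope s(x) of H
   between x and alpha satisfies
     E^{alpha,alpha} - K (alpha - x) <= s(x) <= E^{alpha,x}
       <= sup {L_A(alpha) : A is O(alpha - x)-optimal for Z^alpha}. *)

Require Import Defs.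
From HB Require Import structures.
From mathcomp Require Import all_boot all_order all_algebra.
From mathcomp Require Import all_classical all_reals all_analysis measurable_realfun.
From mathcomp Require Import ring lra.

Set Implicit Arguments.
Unset Strict Implicit.
Unset Printing Implicit Defensive.

Import Order.TTheory GRing.Theory Num.Theory.
Import numFieldNormedType.Exports.

Local Open Scope classical_set_scope.
Local Open Scope ring_scope.

(** * Past algebras and iterates of the bijection *)

Section past_algebras.
Context d (X : measurableType d) (S : X -> X) (S_bij : bijective S).

Lemma iter_inj n : injective (iter n S).
Proof. by elim: n => [//|n IH] x y /= /(bij_inj S_bij) /IH. Qed.

Lemma iter_surj n x : exists y, iter n S y = x.
Proof.
case: S_bij => T _ TK; exists (iter n T x).
by elim: n x => [//|n IH] x; rewrite iterSr iterS TK IH.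
Qed.

Lemma image_preimage_iter n (A : set X) : iter n S @` (iter n S @^-1` A) = A.
Proof.
apply/seteqP; split=> [_ [x Ax <-]//|x Ax].
by have [y yx] := iter_surj n x; exists y => //; rewrite /preimage/= yx.
Qed.

Lemma preimage_image_iter n (A : set X) : iter n S @^-1` (iter n S @` A) = A.
Proof.
apply/seteqP; split=> [x [y Ay /iter_inj <-]//|x Ax]; by exists x.
Qed.

(** Taking the preimage under [S] sends the generators of index i to those of index i + 1. *)
Lemma measurable_shift (B : set (forward_type S)) :
  measurable B -> measurable (S @^-1` B : set (forward_type S)).
Proof.
move=> mB.
have mS : measurable_fun setT (S : forward_type S -> forward_type S).
  apply: (@measurability _ _ (forward_type S) (forward_type S) setT S
    (forward_sets S)) => //.
  move=> _ [_ [i _ [A mA <-]] <-]; rewrite setTI; apply: sub_sigma_algebra.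
  exists i.+1 => //; exists A => //.
  by apply/funext => x; rewrite /preimage/= -iterSr.
by rewrite -[X in measurable X]setTI; exact: mS.
Qed.

Lemma measurable_shiftn n (B : set (forward_type S)) :
  measurable B -> measurable (iter n S @^-1` B : set (forward_type S)).
Proof.
elim: n B => [//|n IH] B mB.
exact: (IH (S @^-1` B) (measurable_shift mB)).
Qed.

(** Bijectivity trades direct images for preimages, so that the closure properties of a past algebra
    reduce to those of [measurable]. *)
Lemma past_algebraE n (A : set X) :
  past_algebra S n A <-> measurable (iter n S @^-1` A : set (forward_type S)).
Proof.
split=> [[B mB <-]|mA]; first by rewrite preimage_image_iter.
by exists (iter n S @^-1` A) => //; exact: image_preimage_iter.
Qed.

Lemma past_algebra_le m n A : (m <= n)%N -> past_algebra S m A ->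
  past_algebra S n A.
Proof.
move=> /subnK <- /past_algebraE mA; apply/past_algebraE.
rewrite (_ : _ @^-1` _ = iter (n - m) S @^-1` (iter m S @^-1` A)).
  exact: measurable_shiftn.
by apply/funext => x /=; rewrite addnC iterD.
Qed.

Lemma past_algebraC n A : past_algebra S n A -> past_algebra S n (~` A).
Proof. by move=> /past_algebraE mA; apply/past_algebraE; exact: measurableC. Qed.

Lemma past_algebraI n A B : past_algebra S n A -> past_algebra S n B ->
  past_algebra S n (A `&` B).
Proof.
by move=> /past_algebraE mA /past_algebraE mB; apply/past_algebraE;
  exact: measurableI.
Qed.

Lemma past_algebraD n A B : past_algebra S n A -> past_algebra S n B ->
  past_algebra S n (A `\` B).
Proof. by move=> nA /past_algebraC nB; rewrite setDE; exact: past_algebraI. Qed.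

Lemma past_algebra_bigcup n (F : nat -> set X) :
  (forall k, past_algebra S n (F k)) -> past_algebra S n (\bigcup_k F k).
Proof.
move=> nF; apply/past_algebraE; rewrite preimage_bigcup.
by apply: bigcup_measurable => k _; exact/past_algebraE.
Qed.

Lemma past_algebra0 n : past_algebra S n set0.
Proof. by apply/past_algebraE; rewrite preimage_set0; exact: measurable0. Qed.

Lemma past_algebraT n : past_algebra S n setT.
Proof. by rewrite -setC0; exact/past_algebraC/past_algebra0. Qed.

Lemma past_algebraU n A B : past_algebra S n A -> past_algebra S n B ->
  past_algebra S n (A `|` B).
Proof.
by move=> /past_algebraE mA /past_algebraE mB; apply/past_algebraE;
  exact: measurableU.
Qed.

Lemma past_algebra_bigsetU n (F : nat -> set X) :
  (forall k, (k <= n)%N -> past_algebra S k (F k)) ->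
  forall m, (m <= n.+1)%N -> past_algebra S n (\big[setU/set0]_(k < m) F k).
Proof.
move=> nF m mn; elim/big_ind: _ => [||i _].
- exact: past_algebra0.
- exact: past_algebraU.
- have im : (i <= n)%N by rewrite -ltnS (leq_trans _ mn).
  exact: past_algebra_le (nF _ im).
Qed.

Lemma two_sided_past_algebra A : two_sided_sets S A ->
  exists n, past_algebra S n A.
Proof.
case=> -[i _ [B mB <-]].
- exists 0%N; apply/past_algebraE; apply: sub_sigma_algebra.
  by exists i => //; exists B.
- exists i; exists B => //; apply: sub_sigma_algebra.
  by exists 0%N => //; exists B.
Qed.

(** The sets removed from [A n] have smaller indices and past algebras increase with the index, so a
    cover can be made disjoint without changing indices. *)
Lemma past_algebra_seqDU (A : nat -> set X) n :
  (forall n, past_algebra S n (A n)) -> past_algebra S n (seqDU A n).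
Proof.
move=> mA; apply: past_algebraD => //; apply: past_algebra_bigsetU => //.
Qed.

End past_algebras.

(** * Outer measures from covers by past sets, and Caratheodory measurability *)

Section dynamical_outer_measure.
Context {R : realType} d (X : measurableType d) (S : X -> X).
Hypothesis S_bij : bijective S.
Variable mu : {measure set (forward_type S) -> \bar R}.
Implicit Types (N n : nat) (Q : set X) (A : nat -> set X).

Local Open Scope ereal_scope.

Definition covers_from N Q : set (nat -> set X) :=
  covers S Q `&` [set A | forall n, (n < N)%N -> A n = set0].

Definition mass A : \bar R := \sum_(0 <= n <oo) mu (pullback S A n).

Definition outer_from N Q : \bar R :=
  ereal_inf [set mass A | A in covers_from N Q].

(* A set of the past algebra at -N splits every cover that starts at N or later,
   so the increasing limit, unlike outer_from 0, makes the whole two-sided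
   sigma-algebra Caratheodory measurable. *)
Definition outer_limit Q : \bar R := ereal_sup (range (outer_from ^~ Q)).

Lemma mass_ge0 A : 0 <= mass A.
Proof. exact: nneseries_ge0. Qed.

Lemma outer_from_ge0 N Q : 0 <= outer_from N Q.
Proof. by apply: le_ereal_inf_tmp => _ [A _ <-]; exact: mass_ge0. Qed.

Lemma outer_from_adherent N Q (e : R) : (0 < e)%R -> outer_from N Q < +oo ->
  exists2 A, covers_from N Q A & mass A < outer_from N Q + e%:E.
Proof.
move=> e0 Qoo; have /(lb_ereal_inf_adherent e0) : outer_from N Q \is a fin_num.
  by rewrite ge0_fin_numE// outer_from_ge0.
by case=> _ [A NA <-] lt; exists A.
Qed.

Lemma outer_from_le N Q A : covers_from N Q A -> outer_from N Q <= mass A.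
Proof. by move=> NA; apply: ereal_inf_lbound; exists A. Qed.

Lemma mass_le A B : (forall n, measurable (pullback S A n)) ->
  (forall n, measurable (pullback S B n)) -> (forall n, A n `<=` B n) ->
  mass A <= mass B.
Proof.
move=> mA mB AB; apply: lee_nneseries => n //.
by move=> _; apply: le_measure; rewrite ?inE => // x; exact: AB.
Qed.

Lemma outer_from_subset N Q Q' : Q `<=` Q' -> outer_from N Q <= outer_from N Q'.
Proof.
move=> QQ'; apply: le_ereal_inf_tmp => _ [A [[mA QA] NA] <-].
by apply: outer_from_le; split => //; split => //; exact: subset_trans QA.
Qed.

Lemma outer_from0 N : outer_from N set0 = 0.
Proof.
apply/eqP; rewrite eq_le outer_from_ge0 andbT.
rewrite (_ : 0 = mass (fun=> set0)).
  by apply: outer_from_le; split => //; split => // n; exact: past_algebra0.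
by rewrite /mass eseries0// => n _ _; rewrite /pullback preimage_set0 measure0.
Qed.

Lemma outer_from_homo m n Q : (m <= n)%N -> outer_from m Q <= outer_from n Q.
Proof.
move=> mn; apply: ereal_inf_le_tmp; apply: image_subset => A [QA nA]; split => //.
by move=> k km; apply: nA; exact: leq_trans mn.
Qed.

Lemma mass_bigcup (G : nat -> nat -> set X) :
  (forall i n, past_algebra S n (G i n)) ->
  mass (fun n => \bigcup_i G i n) <= \sum_(0 <= i <oo) mass (G i).
Proof.
move=> mG; rewrite /mass nneseries_interchange//; apply: lee_nneseries => // n _.
rewrite /pullback preimage_bigcup; apply: measure_sigma_subadditive => //.
- by move=> i; exact/past_algebraE.
- by apply: bigcup_measurable => i _; exact/past_algebraE.
Qed.

(** Almost optimal covers of the sets [F n] are united index by index; each past algebra is closed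
    under countable unions, so the result is again an admissible cover. *)
Lemma outer_from_sigma_subadditive N : sigma_subadditive (outer_from N).
Proof.
move=> F; have [[i Foo]|] := pselect (exists i, outer_from N (F i) = +oo).
  rewrite (eseries_pinfty _ _ Foo) ?leey// => n _.
  by rewrite -ltNye (lt_le_trans _ (outer_from_ge0 _ _)).
rewrite -forallNE => Foo; apply/lee_addgt0Pr => e e0.
apply: le_trans (epsilon_trick _ _ (ltW e0)); last first.
  by move=> n; exact: outer_from_ge0.
have /choice[G GF] n : exists A, covers_from N (F n) A /\
    mass A <= outer_from N (F n) + (e / (2 ^ n.+1)%:R)%:E.
  have en : (0 < e / (2 ^ n.+1)%:R)%R by rewrite divr_gt0// ltr0n expn_gt0.
  have [|A NA lt] := @outer_from_adherent N (F n) _ en.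
    by rewrite ltey; exact/eqP/Foo.
  by exists A; split => //; exact: ltW.
have mG i n : past_algebra S n (G i n) by exact: (GF i).1.1.1.
apply: (@le_trans _ _ (mass (fun n => \bigcup_i G i n))).
  apply: outer_from_le; split; first split.
  - by move=> n; exact: past_algebra_bigcup.
  - move=> x [i _ /(GF i).1.1.2 [n _ Gx]]; by exists n => //; exists i.
  - move=> n nN; rewrite bigcup0// => i _; exact: (GF i).1.2.
apply: le_trans (mass_bigcup mG) _; apply: lee_nneseries => [i _ _|i _].
  exact: mass_ge0.
exact: (GF i).2.
Qed.

HB.instance Definition _ N := isOuterMeasure.Build R X (outer_from N)
  (outer_from0 N) (outer_from_ge0 N) (@outer_from_subset N)
  (outer_from_sigma_subadditive N).

Lemma outer_limit_ub N Q : outer_from N Q <= outer_limit Q.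
Proof. by apply: ereal_sup_ubound; exists N. Qed.

Lemma outer_limit_cvg Q : outer_from n Q @[n --> \oo] --> outer_limit Q.
Proof.
by apply: ereal_nondecreasing_cvgn => m n; exact: outer_from_homo.
Qed.

Lemma outer_limit0 : outer_limit set0 = 0.
Proof.
apply/eqP; rewrite eq_le; apply/andP; split; last first.
  by rewrite -(outer_from0 0); exact: outer_limit_ub.
by apply: ge_ereal_sup => _ [n _ <-]; rewrite outer_from0.
Qed.

Lemma outer_limit_ge0 Q : 0 <= outer_limit Q.
Proof. by apply: le_trans (outer_limit_ub 0 Q); exact: outer_from_ge0. Qed.

Lemma outer_limit_subset : {homo outer_limit : A B / A `<=` B >-> A <= B}.
Proof.
move=> A B AB; apply: ge_ereal_sup => _ [n _ <-].
exact: le_trans (outer_from_subset n AB) (outer_limit_ub _ _).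
Qed.

Lemma outer_limit_sigma_subadditive : sigma_subadditive outer_limit.
Proof.
move=> F; apply: ge_ereal_sup => _ [n _ <-].
apply: le_trans (outer_from_sigma_subadditive n F) _.
apply: lee_nneseries => i *; first exact: outer_from_ge0.
exact: outer_limit_ub.
Qed.

HB.instance Definition _ := isOuterMeasure.Build R X outer_limit
  outer_limit0 outer_limit_ge0 outer_limit_subset outer_limit_sigma_subadditive.

(** For n >= N the traces on [E] and on its complement of a cover starting at n are again covers
    starting at n, and their masses add up. The inequality then passes to the limit in n. *)
Lemma past_algebra_caratheodory N E : past_algebra S N E ->
  outer_limit.-caratheodory E.
Proof.
move=> NE; apply: le_caratheodory_measurable => Y.
have cD : outer_from n (Y `&` E) + outer_from n (Y `&` ~` E) @[n --> \oo] -->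
    outer_limit (Y `&` E) + outer_limit (Y `&` ~` E).
  by apply: cvgeD; [apply: ge0_adde_def; rewrite inE outer_limit_ge0
    |exact: outer_limit_cvg|exact: outer_limit_cvg].
apply: (cvge_to_le cD).
exists N => // n /= Nn; apply: le_trans (outer_limit_ub n Y).
apply: le_ereal_inf_tmp => _ [A [[mA YA] nA] <-].
(* Below n the cover is empty; from n >= N on, [B] belongs to the past algebra of the index. *)
have mAE k B : past_algebra S N B -> past_algebra S k (A k `&` B).
  move=> NB; have [kn|nk] := ltnP k n.
    by rewrite nA// set0I; exact: past_algebra0.
  apply: past_algebraI => //; apply: past_algebra_le NB => //.
  exact: leq_trans nk.
apply: (@le_trans _ _ (mass (fun k => A k `&` E) + mass (fun k => A k `&` ~` E))).
  apply: leeD; apply: outer_from_le; (split; first split) => //.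
  - by move=> k; exact: mAE.
  - by move=> x [/YA[k _ Ax] Ex]; exists k.
  - by move=> k kn; rewrite nA// set0I.
  - by move=> k; apply: mAE => //; exact: past_algebraC.
  - by move=> x [/YA[k _ Ax] Ex]; exists k.
  - by move=> k kn; rewrite nA// set0I.
rewrite /mass -nneseriesD//; apply: lee_nneseries => [k _ _|k _].
  exact: adde_ge0.
rewrite /pullback -measureU.
- by rewrite -preimage_setU -setIUr setUv setIT.
- exact/past_algebraE/mAE.
- exact/past_algebraE/mAE/past_algebraC.
- by rewrite -preimage_setI setIACA setICr setI0 preimage_set0.
Qed.

Lemma two_sided_caratheodory Q : <<s two_sided_sets S >> Q ->
  outer_limit.-caratheodory Q.
Proof.
apply: smallest_sub.
  split.
  - exact: caratheodory_measurable_set0.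
  - by move=> A mA; rewrite setTD; exact: caratheodory_measurable_setC.
  - by move=> F mF; exact: caratheodory_measurable_bigcup.
by move=> A /(two_sided_past_algebra S_bij)[n]; exact: past_algebra_caratheodory.
Qed.

(* A cover (A_n) of X becomes the cover (S^N A_n) at the indices n + N, of equal
   mass because S is onto. *)
Lemma outer_limitT : outer_limit setT = outer_from 0 setT.
Proof.
apply/eqP; rewrite eq_le outer_limit_ub andbT.
apply: ge_ereal_sup => _ [N _ <-].
apply: le_ereal_inf_tmp => _ [A [[mA TA] _] <-].
pose B n := if (n < N)%N then set0 else iter N S @` A (n - N)%N.
have BE k : pullback S B (k + N) = pullback S A k.
  rewrite /pullback /B ltnNge leq_addl/= addnK.
  rewrite [LHS](_ : _ = iter k S @^-1` (iter N S @^-1` (iter N S @` A k))).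
    by rewrite preimage_image_iter.
  by apply/funext => x; rewrite /preimage/= addnC iterD.
have -> : mass A = mass B.
  rewrite /mass [RHS](nneseries_split _ N)// add0n big_nat_cond big1 ?add0e.
    rewrite -nneseries_addn//.
    by apply: eq_eseriesr => k _; rewrite BE.
  by move=> i /andP[/andP[_ iN] _]; rewrite /pullback /B iN preimage_set0 measure0.
apply: outer_from_le; split; first split.
- move=> n; apply/past_algebraE => //; have [nN|Nn] := ltnP n N.
    by rewrite /B nN preimage_set0; exact: measurable0.
  rewrite -(subnK Nn); have := BE (n - N)%N; rewrite /pullback => ->.
  exact/past_algebraE.
- move=> x _; have [y yx] := iter_surj S_bij N x.
  have [k _ Ay] := TA y I; exists (k + N)%N => //.
  by rewrite /B ltnNge leq_addl/= addnK; exists y.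
- by move=> n nN; rewrite /B nN.
Qed.

End dynamical_outer_measure.

(** * Agreement of the two outer measures on the two-sided sigma-algebra *)

Section outer_limit_measure.
Context {R : realType} d (X : measurableType d) (S : X -> X).
Hypothesis S_bij : bijective S.
Variable mu : {measure set (forward_type S) -> \bar R}.
Hypothesis mu_fin : (mu setT < +oo)%E.

Local Open Scope ereal_scope.

Lemma outer_from0_lty Q : outer_from mu 0 Q < +oo.
Proof.
pose A n : set X := if n is 0%N then setT else set0.
have A0 n : A n.+1 = set0 by [].
apply: (@le_lt_trans _ _ (mass mu A)).
  apply: outer_from_le; split=> //; split; last by move=> x _; exists 0%N.
  by case=> [|n]; [exact: past_algebraT|exact: past_algebra0].
rewrite /mass (nneseries_split _ 1)// add0n big_nat1 eseries0 ?adde0//.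
by case=> // n _ _; rewrite /pullback A0 preimage_set0 measure0.
Qed.

(* outer_limit and outer_from 0 agree on X, and the inequality outer_from 0 <=
   outer_limit on Q and on its complement leaves no room. *)
Lemma outer_limitE Q : <<s two_sided_sets S >> Q ->
  outer_limit mu Q = outer_from mu 0 Q.
Proof.
move=> mQ; apply/eqP; rewrite eq_le outer_limit_ub andbT.
have fin P : outer_from mu 0 P \is a fin_num.
  by rewrite ge0_fin_numE ?outer_from0_lty// outer_from_ge0.
(* Caratheodory's criterion for [Q], tested on the whole space. *)
have QT : outer_limit mu Q + outer_limit mu (~` Q) = outer_from mu 0 setT.
  have := two_sided_caratheodory S_bij mu mQ setT.
  by rewrite !setTI => <-; exact: outer_limitT.
have finC : outer_limit mu (~` Q) \is a fin_num.
  rewrite ge0_fin_numE ?outer_limit_ge0//.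
  apply: le_lt_trans (outer_from0_lty setT); rewrite -QT.
  by rewrite leeDr// outer_limit_ge0.
rewrite -(@leeD2rE _ (outer_limit mu (~` Q)))// QT -(setvU Q) setUC.
apply: le_trans (outer_measureU2 (outer_from mu 0) Q (~` Q)) _.
by apply: leeD => //; exact: outer_limit_ub.
Qed.

End outer_limit_measure.

(** * Covers almost optimal for two measures at once *)

Section common_cover.
Context {R : realType} d (X : measurableType d) (S : X -> X).
Hypothesis S_bij : bijective S.
Variables mu Lambda : {finite_measure set (forward_type S) -> \bar R}.
Hypothesis Lambda_inv : forall A : set (forward_type S),
  measurable A -> Lambda (S @^-1` A) = Lambda A.

Local Open Scope ereal_scope.

Lemma measure_shiftn n (B : set (forward_type S)) :
  measurable B -> Lambda (iter n S @^-1` B) = Lambda B.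
Proof.
elim: n B => [//|n IH] B mB; rewrite -[RHS]Lambda_inv//.
by rewrite -[RHS]IH//; exact: measurable_shift.
Qed.

(** By invariance the mass of a past set does not depend on the index at which it is viewed. *)
Lemma measure_past_algebra m n (A : set X) : (m <= n)%N -> past_algebra S m A ->
  Lambda (iter n S @^-1` A) = Lambda (iter m S @^-1` A).
Proof.
move=> mn /(past_algebraE S_bij) mA; rewrite -[RHS](measure_shiftn (n - m) mA).
congr (Lambda _); apply/funext => x.
by rewrite /preimage/= -iterD addnC subnK.
Qed.

(** Sets of different indices are all moved to the common index n, where additivity applies. *)
Lemma measure_bigsetU_shift (G : nat -> set X) n :
  (forall k, past_algebra S k (G k)) -> trivIset setT G ->
  Lambda (iter n S @^-1` (\big[setU/set0]_(k < n) G k)) =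
  \sum_(k < n) Lambda (pullback S G k).
Proof.
move=> mG tG.
have mGn k : (k < n)%N ->
    measurable (iter n S @^-1` G k : set (forward_type S)).
  by move=> kn; apply/past_algebraE => //; exact: past_algebra_le (ltnW kn) (mG k).
rewrite [X in Lambda X](_ : _ =
    \big[setU/set0]_(k < n) (iter n S @^-1` G k)); last first.
  by rewrite -bigcup_mkord preimage_bigcup bigcup_mkord.
rewrite (measure_semi_additive_ord_I Lambda mGn).
- by apply: eq_bigr => k _; exact: measure_past_algebra (ltnW (ltn_ord k)) (mG k).
- move=> i j _ _ [x [Gi Gj]]; apply: tG => //.
  by exists (iter n S x).
- by apply: bigsetU_measurable => k _; exact: mGn.
Qed.

(** For k >= n the k-th partial sum is the mass, at index k, of a disjoint union inside [D], and [D]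
    has the same mass at indices k and n. *)
Lemma mass_disjoint_le (G : nat -> set X) D n :
  (forall k, past_algebra S k (G k)) -> trivIset setT G ->
  past_algebra S n D -> (forall k, G k `<=` D) ->
  mass Lambda G <= Lambda (iter n S @^-1` D).
Proof.
move=> mG tG mD GD; apply: lime_le; first exact: is_cvg_nneseries.
exists n => // k /= nk; rewrite big_mkord -measure_bigsetU_shift//.
rewrite -(measure_past_algebra nk mD); apply: le_measure; rewrite ?inE.
- rewrite -bigcup_mkord preimage_bigcup; apply: bigcup_measurable => i /= ik.
  by apply/past_algebraE => //; exact: past_algebra_le (ltnW ik) (mG i).
- by apply/past_algebraE => //; exact: past_algebra_le nk mD.
- by rewrite -bigcup_mkord => x [i _ /GD].
Qed.

Lemma finite_measure_lty (nu : {finite_measure set (forward_type S) -> \bar R}) :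
  nu setT < +oo.
Proof. by rewrite -ge0_fin_numE// fin_num_measure. Qed.

(* Take C almost optimal for Lambda and N so large that D = C_0 U ... U C_(N-1)
   misses only a part of Q of small (mu + Lambda)-outer measure. By outer_limitE
   there is a cover A of Q almost optimal for mu that starts at N; then the
   disjointed A_n `&` D have total Lambda-mass at most that of D, whatever A. *)
Lemma common_cover Q (e : R) : <<s two_sided_sets S >> Q -> (0 < e)%R ->
  exists A, [/\ covers S Q A, mass mu A < outer_from mu 0 Q + e%:E &
    mass Lambda A < outer_from Lambda 0 Q + e%:E].
Proof.
move=> mQ e0.
have e3 : (0 < e / 3)%R by rewrite divr_gt0.
(* A cover of small mass for the sum is small for both measures. *)
pose kappa : {measure set (forward_type S) -> \bar R} := measure_add mu Lambda.
have kappaE B : kappa B = mu B + Lambda B by exact: measure_addE.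
have kappa_fin : kappa setT < +oo.
  by rewrite kappaE; apply: lte_add_pinfty; exact: finite_measure_lty.
have [C [[mC QC] _] Clt] : exists2 C, covers_from S 0 Q C &
    mass Lambda C < outer_from Lambda 0 Q + (e / 3)%:E.
  apply: outer_from_adherent => //.
  exact (outer_from0_lty S_bij (finite_measure_lty Lambda) Q).
pose E := seqDU C.
have mE k : past_algebra S k (E k) by exact: past_algebra_seqDU.
have QE : Q `<=` \bigcup_k E k by rewrite -seqDU_bigcup_eq.
(* The disjoint measurable pieces [E k] split [Q], so the series is bounded by the finite outer
   measure of [Q] and its tails vanish. *)
have [N Nlt] : exists N,
    \sum_(N <= k <oo) outer_limit kappa (Q `&` E k) < (e / 3)%:E.
  have : \sum_(N <= k <oo) outer_limit kappa (Q `&` E k) @[N --> \oo] --> 0.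
    apply: nneseries_tail_cvg; last by move=> k _; exact: outer_limit_ge0.
    apply: (@le_lt_trans _ _ (outer_limit kappa Q)); last first.
      rewrite (outer_limitE S_bij kappa_fin mQ).
      exact (outer_from0_lty S_bij kappa_fin Q).
    have mEk k := past_algebra_caratheodory S_bij kappa (mE k).
    refine (le_trans _ (caratheodory_lime_le mEk (trivIset_seqDU C) Q)).
    by rewrite leeDl// outer_limit_ge0.
  move=> /(_ [set x | x < (e / 3)%:E]) []; first exact: open_ereal_lt'.
  by move=> N _ Nlt; exists N; apply: Nlt => /=.
pose D := \big[setU/set0]_(k < N) C k.
have mD : past_algebra S N D by apply: past_algebra_bigsetU.
(* A point of [Q] outside [D] lies in some [E k] with k >= N. *)
have QDle : outer_from kappa 0 (Q `\` D) < (e / 3)%:E.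
  apply: le_lt_trans (outer_limit_ub kappa 0 _) _; apply: le_lt_trans Nlt.
  apply: le_trans (outer_measure_sigma_subadditive_tail (outer_limit kappa) N _).
  apply: outer_limit_subset => x [Qx Dx]; have [k _ Ek] := QE x Qx.
  exists k => //= kN; apply: Dx; rewrite /D bigsetU_seqDU -bigcup_mkord.
  by exists k.
have [B [[mB QB] _] Blt] : exists2 B, covers_from S 0 (Q `\` D) B &
    mass kappa B < outer_from kappa 0 (Q `\` D) + (e / 3)%:E.
  apply: outer_from_adherent => //.
  exact (outer_from0_lty S_bij kappa_fin (Q `\` D)).
have {}Blt : mass mu B + mass Lambda B < (e / 3)%:E + (e / 3)%:E.
  rewrite /mass -nneseriesD//.
  rewrite -(@eq_eseriesr _ (fun n => kappa (pullback S B n))) => [|n _]; last first.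
    exact: kappaE.
  by apply: lt_trans Blt _; rewrite lteD2rE.
have oN : outer_from mu N Q <= outer_from mu 0 Q.
  rewrite -(outer_limitE S_bij (finite_measure_lty mu) mQ).
  exact: outer_limit_ub.
have [A [[mA QA] A0] Alt] : exists2 A, covers_from S N Q A &
    mass mu A < outer_from mu N Q + (e / 3)%:E.
  apply: outer_from_adherent => //; apply: le_lt_trans oN _.
  exact (outer_from0_lty S_bij (finite_measure_lty mu) Q).
(* Cutting with [D], a set of index N, is admissible since [A] is empty before N. *)
pose G n := seqDU A n `&` D.
have mG n : past_algebra S n (G n).
  have [nN|Nn] := ltnP n N.
    rewrite (_ : G n = set0); first exact: past_algebra0.
    by apply/seteqP; split => // x [Ax _]; have := subset_seqDU Ax; rewrite A0.
  apply: (past_algebraI S_bij); first exact: past_algebra_seqDU.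
  exact: past_algebra_le mD.
have massU (nu : {measure set (forward_type S) -> \bar R}) :
    mass nu (fun n => G n `|` B n) <= mass nu G + mass nu B.
  rewrite /mass -nneseriesD//; apply: lee_nneseries => // n _.
  by rewrite /pullback preimage_setU measureU2//; exact/past_algebraE.
(* One third of the error is spent on [G], two thirds on the cover [B] of the rest of [Q]. *)
have e3E : e%:E = (e / 3)%:E + ((e / 3)%:E + (e / 3)%:E).
  by rewrite -!EFinD; congr EFin; field.
exists (fun n => G n `|` B n); split.
- split=> [n|x Qx]; first exact: past_algebraU.
  have [Dx|Dx] := pselect (D x); last first.
    by have [n _ Bx] := QB x (conj Qx Dx); exists n => //; right.
  have : (\bigcup_k seqDU A k) x by rewrite -seqDU_bigcup_eq; exact: QA.
  by move=> [n _ Ax]; exists n => //; left.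
- apply: le_lt_trans (massU mu) _; rewrite e3E addeA.
  apply: lteD.
    apply: le_lt_trans (mass_le _ _ _ _) (lt_le_trans Alt _).
    + by move=> n; exact/past_algebraE.
    + by move=> n; exact/past_algebraE.
    + by move=> n x [Ax _]; exact: subset_seqDU Ax.
    + by rewrite leeD2r.
  by apply: le_lt_trans Blt; rewrite leeDl// mass_ge0.
- apply: le_lt_trans (massU Lambda) _; rewrite e3E addeA.
  apply: lteD; last first.
    by apply: le_lt_trans Blt; rewrite leeDr// mass_ge0.
  (* The mass of [D] is the sum of those of the [E k] with k < N, hence at most the mass of [C]. *)
  apply: le_lt_trans Clt; apply: le_trans (mass_disjoint_le mG _ mD _) _.
  + by apply: trivIset_setIr; exact: trivIset_seqDU.
  + by move=> n x [].
  rewrite /D bigsetU_seqDU (measure_bigsetU_shift _ mE (trivIset_seqDU C)).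
  apply: le_trans (nneseries_lim_ge N _) => //; rewrite big_mkord.
  apply: lee_sum => k _; apply: le_measure; rewrite ?inE.
  + exact/past_algebraE.
  + exact/past_algebraE.
  + by move=> x; exact: subset_seqDU.
Unshelve. exact: S_bij.
Qed.

End common_cover.

(** * Pointwise bounds for z^x and z^x log z *)

Section pointwise_bounds.
Context {R : realType}.
Implicit Types a x z : R.

Lemma powR_expR z x : 0 < z -> z `^ x = expR (x * ln z).
Proof. by move=> z0; rewrite /powR gt_eqF. Qed.

(** Convexity in the exponent: 1 + u <= e^u with u = (x - a) log z, multiplied by z^a. *)
Lemma powR_tangent_ge a x z : 0 <= z -> 0 < x -> 0 < a ->
  z `^ a - (a - x) * (z `^ a * ln z) <= z `^ x.
Proof.
move=> z0 x0 a0; have [->|zn0] := eqVneq z 0.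
  by rewrite !powR0 ?gt_eqF// mul0r mulr0 subr0.
have {z0 zn0} z0 : 0 < z by rewrite lt_neqAle eq_sym zn0.
rewrite !powR_expR//; set t := ln z.
have -> : expR (x * t) = expR (a * t) * expR ((x - a) * t).
  by rewrite -expRD; congr expR; ring.
have := expR_ge1Dx ((x - a) * t); have := expR_gt0 (a * t).
nra.
Qed.

Lemma powR_ln_homo a x z : 0 <= z -> 0 < x -> x <= a ->
  z `^ x * ln z <= z `^ a * ln z.
Proof.
move=> z0 x0 xa; have [->|zn0] := eqVneq z 0.
  by rewrite !powR0 ?gt_eqF// (lt_le_trans x0).
have {z0 zn0} z0 : 0 < z by rewrite lt_neqAle eq_sym zn0.
have [z1|z1] := leP 1 z.
  by rewrite ler_wpM2r ?ln_ge0// ler_powR.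
apply: ler_wnM2r; first by rewrite ln_le0// ltW.
by apply: ger_powR => //; rewrite z0 ltW.
Qed.

(** From u <= e^u with u = (1 - a) log z, multiplied by z^a. *)
Lemma powR_ln_le a z : 0 <= z -> 0 < a -> a < 1 ->
  z `^ a * ln z <= z / (1 - a).
Proof.
move=> z0 a0 a1; have [->|zn0] := eqVneq z 0.
  by rewrite !powR0 ?gt_eqF// !mul0r.
have {z0 zn0} z0 : 0 < z by rewrite lt_neqAle eq_sym zn0.
have b0 : 0 < 1 - a by rewrite subr_gt0.
rewrite ler_pdivlMr// powR_expR// -[leRHS]lnK ?posrE//; set t := ln z.
have -> : expR t = expR (a * t) * expR ((1 - a) * t).
  by rewrite -expRD; congr expR; ring.
have := expR_ge1Dx ((1 - a) * t); have := expR_gt0 (a * t).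
nra.
Qed.

(** From 1 - u <= e^(-u) with u = a log z, multiplied by e^u. *)
Lemma powR_ln_ge a z : 0 <= z -> 0 < a -> - a^-1 <= z `^ a * ln z.
Proof.
move=> z0 a0; have [->|zn0] := eqVneq z 0.
  by rewrite !powR0 ?gt_eqF// mul0r oppr_le0 invr_ge0 ltW.
have {z0 zn0} z0 : 0 < z by rewrite lt_neqAle eq_sym zn0.
rewrite -div1r -mulNr ler_pdivrMr// powR_expR//; set t := ln z.
have := expR_ge1Dx (- (a * t)).
have := expRxMexpNx_1 (a * t); have := expR_gt0 (a * t).
set p := expR (a * t); set q := expR (- (a * t)).
nra.
Qed.

Lemma powR_le1D a z : 0 <= z -> 0 < a -> a < 1 -> z `^ a <= 1 + z.
Proof.
move=> z0 a0 a1; have [z1|z1] := leP 1 z.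
  by rewrite (le_trans (ler1_powR z1 (ltW a1)))// lerDr.
rewrite (@le_trans _ _ 1)// ?lerDl//.
have := ge0_ler_powR (ltW a0) z0 (ler01 : 1 \is Num.nneg) (ltW z1).
by rewrite powR1.
Qed.

(** The remainder is at most (a - x)^2 (log z)^2 times z^a if z >= 1, or times z^x if z < 1. In the
    first case u^2 / 2 <= e^u with u = (1 - a) log z absorbs the logarithms into z; in the second
    one logarithm is absorbed by z^(x - a0). *)
Lemma powR_taylor_le a0 a x z : 0 <= z -> 0 < a0 -> a0 < a -> a < 1 ->
  (a0 + a) / 2 <= x -> x <= a ->
  z `^ x <= z `^ a - (a - x) * (z `^ a * ln z) + (a - x) ^+ 2 *
    ((2 / (1 - a) ^+ 2 + 2 / (a - a0) / (1 - a)) * z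
     - 2 / (a - a0) * (z `^ a0 * ln z)).
Proof.
move=> z0 a00 a0a a1 a0x xa.
have a_gt0 : 0 < a by exact: lt_trans a0a.
have b0 : 0 < 1 - a by rewrite subr_gt0.
have c0 : 0 < a - a0 by rewrite subr_gt0.
have x0 : 0 < x by lra.
have [->|zn0] := eqVneq z 0.
  by rewrite !powR0 ?gt_eqF// !(mul0r, mulr0, subr0, add0r, oppr0).
have {z0 zn0} z0 : 0 < z by rewrite lt_neqAle eq_sym zn0.
have c1 : 0 < 2 / (1 - a) ^+ 2 by rewrite divr_gt0// exprn_gt0.
have c2 : 0 < 2 / (a - a0) by rewrite divr_gt0.
set t := ln z; set c := 2 / (a - a0) in c2 *.
suff : z `^ x - z `^ a + (a - x) * (z `^ a * t) <= (a - x) ^+ 2 *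
    ((2 / (1 - a) ^+ 2 + c / (1 - a)) * z - c * (z `^ a0 * t)).
  by move: (_ ^+ 2 * _) (_ * (z `^ a * t)) => u v; lra.
have d0 : 0 <= a - x by rewrite subr_ge0.
set d := a - x in d0 *.
have [t0|t0] := leP 0 t.
(* For z >= 1 the subtracted z^a0 log z is nonnegative; the summand with [c / (1 - a)] compensates
   it. *)
- apply: (@le_trans _ _ (d ^+ 2 * (2 / (1 - a) ^+ 2 * z))); last first.
    have : z `^ a0 * t <= z / (1 - a).
      apply: le_trans (powR_ln_homo (ltW z0) a00 (ltW a0a)) _.
      exact: powR_ln_le (ltW z0) a_gt0 a1.
    rewrite -subr_ge0 => /(mulr_ge0 (ltW c2)) h.
    by rewrite ler_wpM2l ?sqr_ge0//; lra.
  apply: (@le_trans _ _ (d ^+ 2 * (z `^ a * t ^+ 2))).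
    rewrite !powR_expR// -/t.
    have -> : expR (x * t) = expR (a * t) * expR (- (d * t)).
      by rewrite -expRD; congr expR; rewrite /d; ring.
    have u0 : 0 <= d * t by rewrite mulr_ge0.
    (* Multiply by 1 + u, u = [d * t]: the right side becomes 1 + u^3. *)
    have : expR (- (d * t)) <= 1 - d * t + (d * t) ^+ 2.
      have := expR_ge1Dx (d * t); have := expRxMexpNx_1 (d * t).
      have := expR_gt0 (- (d * t)).
      set p := expR (d * t); set q := expR (- (d * t)).
      move=> q0 pq1 p1; have qu : q * (1 + d * t) <= 1 by nra.
      have v0 : 0 < 1 + d * t by lra.
      rewrite -(ler_pM2r v0); apply: le_trans qu _.
      have := exprn_ge0 3 u0; set v := d * t; lra.
    have := expR_gt0 (a * t); set p := expR (a * t); set q := expR (- _).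
    nra.
  rewrite ler_wpM2l ?sqr_ge0// powR_expR// -/t -[X in _ <= _ * X]lnK ?posrE// -/t.
  have -> : expR t = expR (a * t) * expR ((1 - a) * t).
    by rewrite -expRD; congr expR; ring.
  rewrite [leRHS]mulrCA; apply: ler_wpM2l; first exact: expR_ge0.
  rewrite mulrAC ler_pdivlMr ?exprn_gt0//.
  rewrite -exprMn [t * _]mulrC.
  have s0 : 0 <= (1 - a) * t by rewrite mulr_ge0// ltW.
  have := expR_ge1Dxn 1 s0; rewrite (_ : 2`!%:R = 2)//; lra.
- apply: (@le_trans _ _ (d ^+ 2 * (- c * (z `^ a0 * t)))); last first.
    rewrite ler_wpM2l ?sqr_ge0// mulNr lerDr mulr_ge0// ?ltW//.
    by rewrite addr_gt0// divr_gt0.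
  apply: (@le_trans _ _ (d ^+ 2 * (z `^ x * t ^+ 2))).
    rewrite !powR_expR// -/t.
    have -> : expR (a * t) = expR (x * t) * expR (d * t).
      by rewrite -expRD; congr expR; rewrite /d; ring.
    have u0 : d * t <= 0 by rewrite mulr_ge0_le0// ltW.
    have := expR_ge1Dx (d * t); have := expR_gt0 (x * t).
    set p := expR (x * t); set q := expR (d * t) => p0 q1.
    (* Multiply e^u >= 1 + u by 1 - u > 0, where u = [d * t] <= 0. *)
    have : 1 - q * (1 - d * t) <= (d * t) ^+ 2 by nra.
    nra.
  rewrite ler_wpM2l ?sqr_ge0// !powR_expR// -/t.
  have -> : expR (x * t) = expR (a0 * t) * expR ((x - a0) * t).
    by rewrite -expRD; congr expR; ring.
  have e0 : 0 < x - a0 by lra.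
  (* This is s e^(-s) <= 1 with s = -(x - a0) t; the midpoint bound on x gives x - a0 >= (a - a0) /
     2. *)
  have : expR ((x - a0) * t) * (- t) <= c.
    rewrite /c ler_pdivlMr//.
    have := expR_ge1Dx (- ((x - a0) * t)).
    have := expRxMexpNx_1 ((x - a0) * t); have := expR_gt0 ((x - a0) * t).
    set p := expR (_ * t); set q := expR (- _) => p0 pq1 q1.
    have : 0 <= p * (q - (1 - (x - a0) * t)) by apply: mulr_ge0; lra.
    have : 0 <= p * - t * (x - a0 - (a - a0) / 2).
      by apply: mulr_ge0; [apply: mulr_ge0; lra|lra].
    lra.
  have := expR_gt0 (a0 * t).
  set p := expR (a0 * t); set q := expR (_ * t) => p0 qc.
  have : 0 <= p * - t * (c - q * - t) by do 2?apply: mulr_ge0; lra.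
  lra.
Qed.

End pointwise_bounds.

(** * Finite measures given by an integrable density *)

Section density_measure.
Context d (T : measurableType d) {R : realType}.
Variables (phi : {measure set T -> \bar R}) (f : T -> \bar R).
Hypotheses (f0 : forall t, (0 <= f t)%E) (intf : phi.-integrable setT f).

Local Open Scope ereal_scope.

(** The hypotheses are arguments so that the finite measure structure can be inferred from the
    term. *)
Definition density_measure of (forall t, 0 <= f t) & phi.-integrable setT f :=
  fun A => \int[phi]_(t in A) f t.

Local Notation nu := (density_measure f0 intf).

Let nu0 : nu set0 = 0. Proof. exact: integral_set0. Qed.

Let nu_ge0 A : 0 <= nu A. Proof. by apply: integral_ge0 => t _. Qed.

Let nu_sigma_additive : semi_sigma_additive nu.
Proof. exact: semi_sigma_additive_nng_induced (measurable_int _ intf) f0. Qed.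

Let nu_fin : fin_num_fun nu.
Proof.
by move=> A mA; apply: integrable_fin_num => //; exact: integrableS intf.
Qed.

HB.instance Definition _ := isMeasure.Build _ T R nu nu0 nu_ge0 nu_sigma_additive.
HB.instance Definition _ := Measure_isFinite.Build _ T R nu nu_fin.

End density_measure.

(** * Integrals of Z^a and Z^a log Z *)

Section power_integrals.
Context d (T : measurableType d) {R : realType}.
Variables phi Lambda : {finite_measure set T -> \bar R}.
Variable Z : T -> \bar R.
Hypotheses (mZ : measurable_fun setT Z) (Z0 : forall t, (0 <= Z t)%E).
Hypothesis Z_density : forall A, measurable A ->
  Lambda A = (\int[phi]_(t in A) Z t)%E.
Implicit Types (a x : R) (B : set T).

(** [Z] is integrable, hence almost everywhere equal to this real function, for which the pointwise
    bounds are stated. *)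
Let z t := fine (Z t).

Let z0 t : 0 <= z t. Proof. exact: fine_ge0. Qed.

Let mz : measurable_fun setT z. Proof. exact: measurableT_comp. Qed.

Let intZ : phi.-integrable setT Z.
Proof.
apply/integrableP; split => //.
under eq_integral do rewrite gee0_abs//.
by rewrite -Z_density// -ge0_fin_numE// fin_num_measure.
Qed.

Let Z_fin : {ae phi, forall t, Z t = (z t)%:E}.
Proof.
have := integrable_ae measurableT intZ.
by apply: filterS => t /(_ I) Zt; rewrite /z fineK.
Qed.

Let intz : phi.-integrable setT (EFin \o z).
Proof.
apply: le_integrable intZ => //; first exact/measurable_EFinP.
by move=> t _ /=; rewrite /z; case: (Z t) => //=; rewrite leey.
Qed.

Let int1z : phi.-integrable setT (EFin \o (fun t => 1 + z t)).
Proof.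
exact (integrableD measurableT
  (finite_measure_integrable_cst phi 1 measurableT) intz).
Qed.

Lemma integrable_powR a : 0 < a -> a < 1 ->
  phi.-integrable setT (EFin \o (fun t => fine (Z t) `^ a)).
Proof.
move=> a0 a1; apply: le_integrable int1z => //.
  by apply/measurable_EFinP; exact: measurableT_comp (measurable_powR _) mz.
move=> t _ /=; have zt := z0 t.
by rewrite lee_fin -/(z t) !ger0_norm ?powR_ge0 ?addr_ge0 ?powR_le1D.
Qed.

Lemma integrable_poweR a : 0 < a -> a < 1 ->
  phi.-integrable setT (fun t => (Z t `^ a)%E).
Proof.
move=> a0 a1; have int1Z : phi.-integrable setT (cst 1%E \+ Z)%E.
  exact (integrableD measurableT
    (finite_measure_integrable_cst phi 1 measurableT) intZ).
apply: le_integrable int1Z => //.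
  exact: measurableT_comp (measurable_poweR _) mZ.
move=> t _ /=; rewrite !gee0_abs ?poweR_ge0 ?adde_ge0//.
case: (Z t) (Z0 t) => [r r0| |]//=; last by rewrite gt_eqF.
by rewrite lee_fin powR_le1D.
Qed.

(** The lower bound -1 / a and the upper bound z / (1 - a) give domination by a multiple of 1 + z,
    integrable for a finite measure. *)
Lemma integrable_powR_ln a : 0 < a -> a < 1 ->
  phi.-integrable setT (EFin \o (fun t => fine (Z t) `^ a * ln (fine (Z t)))).
Proof.
move=> a0 a1.
have : phi.-integrable setT (EFin \o (fun t => (a^-1 + (1 - a)^-1) * (1 + z t))).
  by have := integrableZl measurableT (a^-1 + (1 - a)^-1) int1z.
apply: le_integrable => //.
  apply/measurable_EFinP; apply: measurable_funM.
    exact: measurableT_comp (measurable_powR _) mz.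
  exact: measurableT_comp (@measurable_ln R) mz.
move=> t _ /=; rewrite lee_fin -/(z t).
have b0 : 0 < 1 - a by rewrite subr_gt0.
have zt := z0 t.
have a10 : 0 < a^-1 by rewrite invr_gt0.
have b10 : 0 < (1 - a)^-1 by rewrite invr_gt0.
rewrite [leRHS]ger0_norm; last by apply: mulr_ge0; lra.
rewrite ler_norml; apply/andP; split.
  by apply: le_trans (powR_ln_ge zt a0); nra.
by apply: le_trans (powR_ln_le zt a0 a1) _; nra.
Qed.

Lemma integral_density B : measurable B ->
  Lambda B = (\int[phi]_(t in B) fine (Z t))%:E.
Proof.
move=> mB; rewrite Z_density// [RHS]fineK; last first.
  by apply: integrable_fin_num => //; exact: integrableS intz.
apply: ae_eq_integral => //.
- exact: measurable_funTS.
- by apply: measurable_funTS; exact/measurable_EFinP.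
- by apply: filterS Z_fin => t ->.
Qed.

Lemma integral_poweR a B : 0 < a -> a < 1 -> measurable B ->
  (\int[phi]_(t in B) (Z t `^ a))%E = (\int[phi]_(t in B) (fine (Z t) `^ a))%:E.
Proof.
move=> a0 a1 mB; rewrite [RHS]fineK; last first.
  by apply: integrable_fin_num => //; apply: integrableS (integrable_powR a0 a1).
apply: ae_eq_integral => //.
- by apply: measurable_funTS; exact: measurableT_comp (measurable_poweR _) mZ.
- apply: measurable_funTS; apply/measurable_EFinP.
  exact: measurableT_comp (measurable_powR _) mz.
- by apply: filterS Z_fin => t Zt _; rewrite {1}Zt.
Qed.

(** At [Z t = 0] both products vanish with the power; at +oo, [fine] would yield 0, hence the case
    distinction. *)
Lemma poweR_lneE a t : 0 < a ->
  (Z t `^ a * lne (Z t))%E =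
  if Z t == +oo%E then +oo%E else (z t `^ a * ln (z t))%:E.
Proof.
move=> a0; rewrite /z; case: (Z t) (Z0 t) => [r| |]//=; last first.
  by move=> _; rewrite gt_eqF// mulyy.
rewrite lee_fin le_eqVlt => /predU1P[<-|r0].
  by rewrite lexx powR0 ?gt_eqF// mul0e mul0r.
by rewrite leNgt r0.
Qed.

Lemma integral_poweR_lne a B : 0 < a -> a < 1 -> measurable B ->
  (\int[phi]_(t in B) (Z t `^ a * lne (Z t)))%E =
  (\int[phi]_(t in B) (fine (Z t) `^ a * ln (fine (Z t))))%:E.
Proof.
move=> a0 a1 mB; rewrite [RHS]fineK; last first.
  by apply: integrable_fin_num => //; apply: integrableS (integrable_powR_ln a0 a1).
have mln : measurable_fun setT (fun t => (z t `^ a * ln (z t))%:E).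
  by have /integrableP[] := integrable_powR_ln a0 a1.
apply: ae_eq_integral => //.
- apply: measurable_funTS; apply: eq_measurable_fun.
    by move=> t _; rewrite poweR_lneE.
  apply: measurable_fun_ifT => //.
  exact: measurable_fun_eqe.
- exact: measurable_funTS.
- apply: filterS Z_fin => t Zt _; rewrite poweR_lneE//.
  by case: ifPn => //; rewrite Zt.
Qed.

Lemma Rintegral_powR_tangent a x B : 0 < x -> 0 < a -> x < 1 -> a < 1 ->
  measurable B ->
  \int[phi]_(t in B) (fine (Z t) `^ a) -
    (a - x) * \int[phi]_(t in B) (fine (Z t) `^ a * ln (fine (Z t))) <=
  \int[phi]_(t in B) (fine (Z t) `^ x).
Proof.
move=> x0 a0 x1 a1 mB.
have ip y : 0 < y -> y < 1 ->
    phi.-integrable B (EFin \o (fun t => z t `^ y)).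
  by move=> y0 y1; apply: integrableS (integrable_powR y0 y1).
have il : phi.-integrable B (EFin \o (fun t => z t `^ a * ln (z t))).
  exact: integrableS (integrable_powR_ln a0 a1).
have il' : phi.-integrable B (EFin \o (fun t => (a - x) * (z t `^ a * ln (z t)))).
  by have := integrableZl mB (a - x) il.
rewrite -RintegralZl// -RintegralB//; last exact: ip.
apply: le_Rintegral => //; [|exact: ip|].
  by have := integrableB mB (ip _ a0 a1) il'.
by move=> t _; exact: powR_tangent_ge (z0 t) x0 a0.
Qed.

Lemma Rintegral_powR_ln_homo a x B : 0 < x -> x <= a -> a < 1 -> measurable B ->
  \int[phi]_(t in B) (fine (Z t) `^ x * ln (fine (Z t))) <=
  \int[phi]_(t in B) (fine (Z t) `^ a * ln (fine (Z t))).
Proof.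
move=> x0 xa a1 mB; have a0 := lt_le_trans x0 xa; have x1 := le_lt_trans xa a1.
apply: le_Rintegral => //.
- exact: integrableS (integrable_powR_ln x0 x1).
- exact: integrableS (integrable_powR_ln a0 a1).
- by move=> t _; exact: powR_ln_homo (z0 t) x0 xa.
Qed.

Lemma Rintegral_powR_ln_le a B : 0 < a -> a < 1 -> measurable B ->
  \int[phi]_(t in B) (fine (Z t) `^ a * ln (fine (Z t))) <=
  (1 - a)^-1 * \int[phi]_(t in B) fine (Z t).
Proof.
move=> a0 a1 mB.
have iz : phi.-integrable B (EFin \o z) by exact: integrableS intz.
rewrite -RintegralZl//; apply: le_Rintegral => //.
- exact: integrableS (integrable_powR_ln a0 a1).
- by have := integrableZl mB (1 - a)^-1 iz.
- by move=> t _; rewrite [leRHS]mulrC; exact: powR_ln_le (z0 t) a0 a1.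
Qed.

Lemma Rintegral_powR_taylor_le a0 a x B : 0 < a0 -> a0 < a -> a < 1 ->
  (a0 + a) / 2 <= x -> x <= a -> measurable B ->
  \int[phi]_(t in B) (fine (Z t) `^ x) <=
  \int[phi]_(t in B) (fine (Z t) `^ a)
  - (a - x) * \int[phi]_(t in B) (fine (Z t) `^ a * ln (fine (Z t)))
  + (a - x) ^+ 2 *
    ((2 / (1 - a) ^+ 2 + 2 / (a - a0) / (1 - a)) * \int[phi]_(t in B) fine (Z t)
     - 2 / (a - a0) *
       \int[phi]_(t in B) (fine (Z t) `^ a0 * ln (fine (Z t)))).
Proof.
move=> a00 a0a a1 a0x xa mB.
have a_gt0 : 0 < a by exact: lt_trans a0a.
have a01 : a0 < 1 by exact: lt_trans a1.
have x0 : 0 < x by lra.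
have x1 : x < 1 by exact: le_lt_trans a1.
have iZ k f : phi.-integrable B (EFin \o f) ->
    phi.-integrable B (EFin \o (fun t => k * f t)).
  by move=> jf; have := integrableZl mB k jf.
have iD f g : phi.-integrable B (EFin \o f) -> phi.-integrable B (EFin \o g) ->
    phi.-integrable B (EFin \o (fun t => f t + g t)).
  by move=> jf jg; have := integrableD mB jf jg.
have iB f g : phi.-integrable B (EFin \o f) -> phi.-integrable B (EFin \o g) ->
    phi.-integrable B (EFin \o (fun t => f t - g t)).
  by move=> jf jg; have := integrableB mB jf jg.
have ip y : 0 < y -> y < 1 ->
    phi.-integrable B (EFin \o (fun t => z t `^ y)).
  by move=> y0 y1; apply: integrableS (integrable_powR y0 y1).
have il y : 0 < y -> y < 1 ->
    phi.-integrable B (EFin \o (fun t => z t `^ y * ln (z t))).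
  by move=> y0 y1; apply: integrableS (integrable_powR_ln y0 y1).
have iz : phi.-integrable B (EFin \o z) by exact: integrableS intz.
have ipl := iB _ _ (ip _ a_gt0 a1) (iZ (a - x) _ (il _ a_gt0 a1)).
have izl := iB _ _ (iZ (2 / (1 - a) ^+ 2 + 2 / (a - a0) / (1 - a)) _ iz)
  (iZ (2 / (a - a0)) _ (il _ a00 a01)).
apply: le_trans (le_Rintegral mB (ip _ x0 x1)
  (iD _ _ ipl (iZ ((a - x) ^+ 2) _ izl)) _) _.
  by move=> t _; exact: powR_taylor_le (z0 t) a00 a0a a1 a0x xa.
rewrite RintegralD//; last exact: iZ.
rewrite RintegralB//; [|exact: ip|exact/iZ/il].
rewrite !RintegralZl//; last exact: il.
rewrite RintegralB//; [|exact: iZ|exact/iZ/il].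
by rewrite !RintegralZl//; exact: il.
Qed.

End power_integrals.

(** * Series with terms of variable sign *)

Section series_of_reals.
Context {R : realType}.
Implicit Types u v w : R^nat.

Lemma eseries_EFin u : cvgn (series u) ->
  (\sum_(0 <= n <oo) (u n)%:E)%E = (limn (series u))%:E.
Proof.
move=> cu; rewrite -EFin_lim//; congr (limn _).
by apply/funext => n /=; rewrite sumEFin.
Qed.

Lemma is_cvg_series_between u v w : (forall n, u n <= v n <= w n) ->
  cvgn (series u) -> cvgn (series w) -> cvgn (series v).
Proof.
move=> uvw cu cw; have -> : v = u + (v - u) by rewrite addrC subrK.
apply: is_cvg_seriesD => //.
apply: (@series_le_cvg _ _ (w - u)) => [n|n|n|].
- by rewrite subr_ge0; case/andP: (uvw n).
- by rewrite subr_ge0; case/andP: (uvw n) => /le_trans; exact.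
- by rewrite lerB//; case/andP: (uvw n).
- exact: is_cvg_seriesB.
Qed.

(** The nonnegative series of [v - u] converges or has sum +oo; the latter would force the sum of
    [u] to be -oo. *)
Lemma is_cvg_series_ub u v : (forall n, u n <= v n) -> cvgn (series v) ->
  (-oo < \sum_(0 <= n <oo) (u n)%:E)%E -> cvgn (series u).
Proof.
move=> uv cv uNy; have w0 n : 0 <= (v - u) n by rewrite subr_ge0.
suff : cvgn (series (v - u)).
  move=> cw; have -> : u = v - (v - u) by rewrite opprB addrC subrK.
  exact: is_cvg_seriesB.
apply: nnseries_is_cvg => //; rewrite ltey; apply/eqP => woo.
suff uE : (\sum_(0 <= n <oo) (u n)%:E = -oo)%E by move: uNy; rewrite uE.
apply/cvg_lim => //.
have cw : (\sum_(0 <= k < n) ((v - u) k)%:E)%E @[n --> \oo] --> +oo%E.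
  by rewrite -woo; apply: is_cvg_nneseries => n _ _; rewrite lee_fin.
have cv' : (series v n)%:E @[n --> \oo] --> (limn (series v))%:E.
  by apply: cvg_EFin => //; exact: nearW.
rewrite (_ : (fun n => _) = (fun n => (series v n)%:E -
    \sum_(0 <= k < n) ((v - u) k)%:E)%E); last first.
  apply/funext => n; rewrite !sumEFin -EFinB; congr EFin.
  by rewrite /series/= -sumrB; apply: eq_bigr => i _; rewrite subKr.
by have := cvgeB _ cv' cw; apply.
Qed.

(** Sums the tangent and Taylor bounds over a cover. The type [R^o^nat] makes the constant factors
    scalar multiplications. *)
Lemma lim_series_between (p l m l0 q : R^o^nat) (D c1 c2 : R) :
  cvgn (series p) -> cvgn (series l) -> cvgn (series m) -> cvgn (series l0) ->
  (forall n, p n - D * l n <= q n) ->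
  (forall n, q n <= p n - D * l n + D ^+ 2 * (c1 * m n - c2 * l0 n)) ->
  cvgn (series q) /\
  limn (series p) - D * limn (series l) <= limn (series q) <=
  limn (series p) - D * limn (series l) + D ^+ 2 *
    (c1 * limn (series m) - c2 * limn (series l0)).
Proof.
move=> cp cl cm cl0 pq qp.
have cZ k (f : R^o^nat) : cvgn (series f) -> cvgn (series (k *: f)).
  by move=> cf; exact: is_cvg_seriesZ.
pose u := p - D *: l; pose v := c1 *: m - c2 *: l0.
have cu : cvgn (series u) := is_cvg_seriesB cp (cZ D _ cl).
have cv : cvgn (series v) := is_cvg_seriesB (cZ c1 _ cm) (cZ c2 _ cl0).
have cuv : cvgn (series (u + D ^+ 2 *: v)) := is_cvg_seriesD cu (cZ _ _ cv).
have cq : cvgn (series q).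
  by apply: (is_cvg_series_between _ cu cuv) => n; rewrite pq qp.
have := lim_series_le cu cq pq; have := lim_series_le cq cuv qp.
rewrite (lim_seriesD cu (cZ _ _ cv)) (lim_seriesZ _ cv).
rewrite (lim_seriesB cp (cZ D _ cl)) (lim_seriesZ _ cl).
rewrite (lim_seriesB (cZ c1 _ cm) (cZ c2 _ cl0)) (lim_seriesZ _ cm) (lim_seriesZ _ cl0).
by move=> *; split=> //; apply/andP.
Qed.

End series_of_reals.

(** * Estimates along a single cover *)

Section cover_sums.
Context {R : realType} d (X : measurableType d) (S : X -> X).
Hypothesis S_bij : bijective S.
Variables phi0 Lambda : {finite_measure set (forward_type S) -> \bar R}.
Variable Z : forward_type S -> \bar R.
Hypothesis Z_meas : measurable_fun [set: forward_type S] Z.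
Hypothesis Z_ge0 : forall x, (0 <= Z x)%E.
Hypothesis Z_density : forall A : set (forward_type S),
  measurable A -> Lambda A = (\int[phi0]_(z in A) Z z)%E.
Variable Q : set X.
Implicit Types (A : nat -> set X) (a x : R).

Let lam A n := \int[phi0]_(t in pullback S A n) fine (Z t).
Let pow a A n := \int[phi0]_(t in pullback S A n) (fine (Z t) `^ a).
Let plog a A n :=
  \int[phi0]_(t in pullback S A n) (fine (Z t) `^ a * ln (fine (Z t))).

Let mcover A n : covers S Q A -> measurable (pullback S A n).
Proof. by move=> [mA _]; exact/past_algebraE. Qed.

Let measure_sumE A : covers S Q A ->
  measure_sum Lambda A = (\sum_(0 <= n <oo) (lam A n)%:E)%E.
Proof.
move=> QA; apply: eq_eseriesr => n _.
exact: (integral_density Z_meas Z_ge0 Z_density (mcover n QA)).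
Qed.

Let power_sumE a A : 0 < a -> a < 1 -> covers S Q A ->
  power_sum phi0 Z a A = (\sum_(0 <= n <oo) (pow a A n)%:E)%E.
Proof.
move=> a0 a1 QA; apply: eq_eseriesr => n _.
exact: (integral_poweR Z_meas Z_ge0 Z_density a0 a1 (mcover n QA)).
Qed.

Let power_log_sumE a A : 0 < a -> a < 1 -> covers S Q A ->
  power_log_sum phi0 Z a A = (\sum_(0 <= n <oo) (plog a A n)%:E)%E.
Proof.
move=> a0 a1 QA; apply: eq_eseriesr => n _.
exact: (integral_poweR_lne Z_meas Z_ge0 Z_density a0 a1 (mcover n QA)).
Qed.

Let lam_ge0 A n : 0 <= lam A n.
Proof. by apply: Rintegral_ge0 => t _; exact: fine_ge0. Qed.

Let pow_ge0 a A n : 0 <= pow a A n.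
Proof. by apply: Rintegral_ge0 => t _; exact: powR_ge0. Qed.

(** Termwise, the tangent bound at a is combined with Z^a log Z <= Z / (1 - a). *)
Lemma power_sum_le a x A : 0 < x -> x < a -> a < 1 -> covers S Q A ->
  (power_sum phi0 Z a A <=
   power_sum phi0 Z x A + ((a - x) / (1 - a))%:E * measure_sum Lambda A)%E.
Proof.
move=> x0 xa a1 QA; have a0 := lt_trans x0 xa; have x1 := lt_trans xa a1.
have c0 : 0 <= (a - x) / (1 - a) by rewrite divr_ge0// subr_ge0 ltW.
rewrite !power_sumE// measure_sumE// -nneseriesZl => [|n _]; last first.
  by rewrite lee_fin.
rewrite -nneseriesD => [|n _ _|n _ _]; rewrite ?mule_ge0 ?lee_fin//.
apply: lee_nneseries => n _; first by rewrite lee_fin.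
rewrite -EFinM -EFinD lee_fin.
have := Rintegral_powR_tangent Z_meas Z_ge0 Z_density x0 a0 x1 a1 (mcover n QA).
have := Rintegral_powR_ln_le Z_meas Z_ge0 Z_density a0 a1 (mcover n QA).
rewrite -/(lam A n) -/(pow a A n) -/(pow x A n) -/(plog a A n).
have d0 : 0 <= a - x by rewrite subr_ge0 ltW.
by move=> /(ler_wpM2l d0); lra.
Qed.

(** The logarithmic terms for a0 lie below those for a, which lie below the convergent series for
    [Lambda] over 1 - a. A sum above -oo at a0 thus makes both logarithmic series converge, and all
    sums become real. *)
Lemma cover_estimates a0 a A : 0 < a0 -> a0 < a -> a < 1 -> covers S Q A ->
  (measure_sum Lambda A < +oo)%E -> (power_sum phi0 Z a A < +oo)%E ->
  (-oo < power_log_sum phi0 Z a0 A)%E ->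
  exists m p L L0 : R, [/\ measure_sum Lambda A = m%:E,
    power_sum phi0 Z a A = p%:E, power_log_sum phi0 Z a A = L%:E,
    power_log_sum phi0 Z a0 A = L0%:E &
    [/\ 0 <= m, L0 <= L, L <= (1 - a)^-1 * m &
     forall x, (a0 + a) / 2 <= x -> x <= a ->
       exists2 q, power_sum phi0 Z x A = q%:E &
         p - (a - x) * L <= q <= p - (a - x) * L + (a - x) ^+ 2 *
           ((2 / (1 - a) ^+ 2 + 2 / (a - a0) / (1 - a)) * m
            - 2 / (a - a0) * L0)]].
Proof.
move=> a00 a0a a1 QA; have a_gt0 := lt_trans a00 a0a; have a01 := lt_trans a0a a1.
rewrite measure_sumE// power_sumE// !power_log_sumE// => moo poo LNy.
have cm : cvgn (series (lam A)) by exact: nnseries_is_cvg.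
have cp : cvgn (series (pow a A)) by exact: nnseries_is_cvg.
have cmZ k : cvgn (series (k *: lam A)) by exact: is_cvg_seriesZ.
have L0L n : plog a0 A n <= plog a A n.
  exact: (Rintegral_powR_ln_homo Z_meas Z_ge0 Z_density a00 (ltW a0a) a1 (mcover n QA)).
have Lm n : plog a A n <= ((1 - a)^-1 *: lam A) n.
  exact: (Rintegral_powR_ln_le Z_meas Z_ge0 Z_density a_gt0 a1 (mcover n QA)).
have cL0 : cvgn (series (plog a0 A)).
  apply: (is_cvg_series_ub _ (cmZ (1 - a)^-1) LNy) => n.
  exact: le_trans (L0L n) (Lm n).
have cL : cvgn (series (plog a A)).
  apply: (is_cvg_series_between _ cL0 (cmZ (1 - a)^-1)) => n.
  by apply/andP; split; [exact: L0L|exact: Lm].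
exists (limn (series (lam A))), (limn (series (pow a A))),
  (limn (series (plog a A))), (limn (series (plog a0 A))).
split; [exact: eseries_EFin cm|exact: eseries_EFin cp|exact: eseries_EFin cL
  |exact: eseries_EFin cL0|split].
- have := eseries_EFin cm => mE.
  by rewrite -lee_fin -mE; apply: nneseries_ge0 => n _ _; rewrite lee_fin.
- exact: lim_series_le cL0 cL L0L.
- have := lim_series_le cL (cmZ (1 - a)^-1) Lm.
  by rewrite (lim_seriesZ _ cm).
move=> x a0x xa.
have x0 : 0 < x by lra.
have x1 : x < 1 by exact: le_lt_trans a1.
have [cq qE] := lim_series_between cp cL cm cL0
  (fun n => Rintegral_powR_tangent Z_meas Z_ge0 Z_density x0 a_gt0 x1 a1 (mcover n QA))
  (fun n => Rintegral_powR_taylor_le Z_meas Z_ge0 Z_density a00 a0a a1 a0x xa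
    (mcover n QA)).
exists (limn (series (pow x A))); last exact: qE.
by rewrite power_sumE//; exact: eseries_EFin cq.
Qed.

End cover_sums.

(** * Monotone limits at 0 and convergence to a finite value *)

Section one_sided_limits.
Context {R : realType}.
Local Open Scope ereal_scope.

(** Suprema over covers grow with the tolerance, so their limit is an infimum; the dual lemma below
    serves infima over covers. *)
Lemma lim_at_right0_nondecreasing (g : R -> \bar R) :
  (forall e e', (0 < e)%R -> (e <= e')%R -> g e <= g e') ->
  lim (g e @[e --> (0:R)^'+]) = ereal_inf [set g e | e in [set e | (0 < e)%R]].
Proof.
move=> gle; have := @nondecreasing_at_right_cvge R g 0%R +oo%O isT.
rewrite (_ : [set` _] = [set e | (0 < e)%R]); last first.
  by apply/seteqP; split=> e /=; rewrite in_itv/= andbT.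
move=> gcvg; apply/cvg_lim => //; apply: gcvg => e e'.
by rewrite !in_itv/= !andbT => e0 _; exact: gle.
Qed.

Lemma lim_at_right0_nonincreasing (g : R -> \bar R) :
  (forall e e', (0 < e)%R -> (e <= e')%R -> g e' <= g e) ->
  lim (g e @[e --> (0:R)^'+]) = ereal_sup [set g e | e in [set e | (0 < e)%R]].
Proof.
move=> gle; have := @nonincreasing_at_right_cvge R g 0%R +oo%O isT.
rewrite (_ : [set` _] = [set e | (0 < e)%R]); last first.
  by apply/seteqP; split=> e /=; rewrite in_itv/= andbT.
move=> gcvg; apply/cvg_lim => //; apply: gcvg => e e'.
by rewrite !in_itv/= !andbT => e0 _; exact: gle.
Qed.

Lemma cvge_fin_near {T : Type} {F : set_system T} {FF : Filter F}
    (f : T -> \bar R) (l : R) :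
  (forall e, (0 < e)%R -> \forall x \near F, (l - e)%:E <= f x <= (l + e)%:E) ->
  f @ F --> l%:E.
Proof.
move=> fl; apply/fine_cvgP; split.
  apply: filterS (fl 1%R ltr01) => x /andP[lf fl1].
  by rewrite fin_numE gt_eqF ?lt_eqF//;
    [exact: le_lt_trans fl1 (ltry _)|exact: lt_le_trans (ltNyr _) lf].
apply/cvgrPdist_le => e /fl; apply: filterS => x /=.
by case: (f x) => [r| |]; rewrite ?lee_fin ?leye_eq ?leeNy_eq ?andbF//= ler_distlC.
Qed.

End one_sided_limits.

(** * Covers almost optimal for both Lambda and Z^x *)

Section left_derivative.
Context {R : realType} d (X : measurableType d) (S : X -> X).
Hypothesis S_bij : bijective S.
Variables phi0 Lambda : {finite_measure set (forward_type S) -> \bar R}.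
Hypothesis Lambda_inv : forall A : set (forward_type S),
  measurable A -> Lambda (S @^-1` A) = Lambda A.
Variable Z : forward_type S -> \bar R.
Hypothesis Z_meas : measurable_fun [set: forward_type S] Z.
Hypothesis Z_ge0 : forall x, (0 <= Z x)%E.
Hypothesis Z_density : forall A : set (forward_type S),
  measurable A -> Lambda A = (\int[phi0]_(z in A) Z z)%E.
Variable Q : set X.
Hypothesis Q_meas : <<s two_sided_sets S >> Q.
Implicit Types (A : nat -> set X) (a x e : R).

Local Open Scope ereal_scope.

Lemma power_sum_ge0 x A : 0 <= power_sum phi0 Z x A.
Proof.
by apply: nneseries_ge0 => n _ _; apply: integral_ge0 => t _; exact: poweR_ge0.
Qed.

Lemma covers_from0 : covers_from S 0 Q = covers S Q.
Proof. by apply/seteqP; split => A [] //; split. Qed.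

Lemma Lambda_outerE : Lambda_outer Lambda Q = outer_from Lambda 0 Q.
Proof. by rewrite /outer_from covers_from0. Qed.

(** Presents [H] as the outer measure of a finite measure, so that [common_cover] applies to it. *)
Definition power_measure x (x0 : (0 < x)%R) (x1 : (x < 1)%R) :
    {finite_measure set (forward_type S) -> \bar R} :=
  density_measure (fun t => poweR_ge0 (Z t) x)
    (integrable_poweR Z_meas Z_ge0 Z_density x0 x1).

Lemma H_outer_from x (x0 : (0 < x)%R) (x1 : (x < 1)%R) :
  H phi0 Z x Q = outer_from (power_measure x0 x1) 0 Q.
Proof. by rewrite /outer_from covers_from0. Qed.

Lemma Lambda_outer_fin_num : Lambda_outer Lambda Q \is a fin_num.
Proof.
rewrite Lambda_outerE ge0_fin_numE ?outer_from_ge0//.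
exact (outer_from0_lty S_bij (finite_measure_lty Lambda) Q).
Qed.

Lemma H_fin_num x : (0 < x)%R -> (x < 1)%R -> H phi0 Z x Q \is a fin_num.
Proof.
move=> x0 x1; rewrite (H_outer_from x0 x1) ge0_fin_numE ?outer_from_ge0//.
exact (outer_from0_lty S_bij (finite_measure_lty (power_measure x0 x1)) Q).
Qed.

Lemma common_cover_power x e : (0 < x)%R -> (x < 1)%R -> (0 < e)%R ->
  exists A, [/\ covers S Q A, power_sum phi0 Z x A < H phi0 Z x Q + e%:E &
    measure_sum Lambda A < Lambda_outer Lambda Q + e%:E].
Proof.
move=> x0 x1 e0; rewrite (H_outer_from x0 x1) Lambda_outerE.
exact (common_cover S_bij (power_measure x0 x1) Lambda_inv Q_meas e0).
Qed.

(** The function under the limit is constant for e > 0: for any r > 0 a common cover with error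
    min(e, r) meets the constraint and comes within r of the infimum. *)
Lemma H1E x : (0 < x)%R -> (x < 1)%R -> H1 Lambda phi0 Z x Q = H phi0 Z x Q.
Proof.
move=> x0 x1; apply: lim_near_cst => //; near=> e.
have e0 : (0 < e)%R by near: e; exact: nbhs_right_gt.
apply/eqP; rewrite eq_le; apply/andP; split; last first.
  by apply: ereal_inf_le_tmp; apply: image_subset => A [].
apply/lee_addgt0Pr => r r0.
have er0 : (0 < Num.min e r)%R by rewrite lt_min e0.
have [A [QA pA mA]] := common_cover_power x0 x1 er0.
apply: (@le_trans _ _ (power_sum phi0 Z x A)).
  apply: ereal_inf_lbound; exists A => //; split => //=.
  by apply: lt_le_trans mA _; rewrite leeD2l// lee_fin ge_min lexx.
by apply: (le_trans (ltW pA)); rewrite leeD2l// lee_fin ge_min lexx orbT.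
Unshelve. all: by end_near. Qed.

Lemma coversH1E x e A : (0 < x)%R -> (x < 1)%R ->
  coversH1 Lambda phi0 Z x e Q A <-> [/\ covers S Q A,
    measure_sum Lambda A < Lambda_outer Lambda Q + e%:E &
    power_sum phi0 Z x A < H phi0 Z x Q + e%:E].
Proof.
move=> x0 x1; rewrite /coversH1 /covers1 H1E//.
by split=> [[[QA mA] pA]|[QA mA pA]].
Qed.

Lemma coversH1_nonempty x e : (0 < x)%R -> (x < 1)%R -> (0 < e)%R ->
  coversH1 Lambda phi0 Z x e Q !=set0.
Proof.
move=> x0 x1 e0; have [A [QA pA mA]] := common_cover_power x0 x1 e0.
by exists A; apply/coversH1E.
Qed.

Lemma coversH1_homo x e e' : (e <= e')%R ->
  coversH1 Lambda phi0 Z x e Q `<=` coversH1 Lambda phi0 Z x e' Q.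
Proof.
move=> ee' A [[QA /= mA] /= pA]; split; [split => //=|rewrite /=].
- by apply: lt_le_trans mA _; rewrite leeD2l.
- by apply: lt_le_trans pA _; rewrite leeD2l.
Qed.

Definition sup_log a x e : \bar R :=
  ereal_sup [set power_log_sum phi0 Z a A | A in coversH1 Lambda phi0 Z x e Q].

Lemma sup_log_homo a x e e' : (e <= e')%R -> sup_log a x e <= sup_log a x e'.
Proof.
move=> ee'; apply: ge_ereal_sup => _ [A cA <-]; apply: ereal_sup_ubound.
by exists A => //; exact: coversH1_homo cA.
Qed.

Lemma sup_log_ub a x e A : coversH1 Lambda phi0 Z x e Q A ->
  power_log_sum phi0 Z a A <= sup_log a x e.
Proof. by move=> cA; apply: ereal_sup_ubound; exists A. Qed.

Lemma E1E a x :
  E1 Lambda phi0 Z a x Q = ereal_inf [set sup_log a x e | e in [set e | (0 < e)%R]].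
Proof.
by apply: lim_at_right0_nondecreasing => e e' _; exact: sup_log_homo.
Qed.

Lemma E1_le a x e : (0 < e)%R -> E1 Lambda phi0 Z a x Q <= sup_log a x e.
Proof. by move=> e0; rewrite E1E; apply: ereal_inf_lbound; exists e. Qed.

(** As a supremum over tolerances, [D1] exceeds -oo only if the infimum does so for one
    tolerance. *)
Lemma D1_lower_bound a x : -oo < D1 Lambda phi0 Z a x Q ->
  exists M e, (0 < e)%R /\
    forall A, coversH1 Lambda phi0 Z x e Q A -> M%:E <= power_log_sum phi0 Z a A.
Proof.
rewrite /D1 lim_at_right0_nonincreasing => [|e e' _ ee']; last first.
  by apply: ereal_inf_le_tmp; apply: image_subset; exact: coversH1_homo.
move=> /ereal_sup_gt[_ [e e0 <-]] /=.
set I := ereal_inf _ => Ioo.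
have [M MI] : exists M : R, M%:E <= I.
  by case: I Ioo => [r _| _|//]; [exists r|exists 0%R; rewrite leey].
exists M, e; split=> // A cA; apply: le_trans MI _.
by apply: ereal_inf_lbound; exists A.
Qed.

(** * Uniform estimates and the one-sided slopes *)

Section estimates.
Variables a0 a M e1 : R.
Hypotheses (a00 : (0 < a0)%R) (a0a : (a0 < a)%R) (a1 : (a < 1)%R).
Hypotheses (e10 : (0 < e1)%R) (e11 : (e1 <= 1)%R) (M0 : (M <= 0)%R).
Hypothesis LM : forall A, coversH1 Lambda phi0 Z a e1 Q A ->
  M%:E <= power_log_sum phi0 Z a0 A.

Local Open Scope ring_scope.

Let h x := fine (H phi0 Z x Q).
Let o := fine (Lambda_outer Lambda Q).
(** [c] and [K] are the constants of [cover_estimates] with the mass replaced by its bound [o + 1]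
    and the logarithmic sum at a0 by its bound [M]; they no longer depend on the cover. *)
Let c := (1 - a)^-1 * (o + 1).
Let K := (2 / (1 - a) ^+ 2 + 2 / (a - a0) / (1 - a)) * (o + 1)
  - 2 / (a - a0) * M.

Let a_gt0 : 0 < a. Proof. exact: lt_trans a0a. Qed.

Let left_gt0 x : (a0 + a) / 2 <= x -> 0 < x.
Proof. by have := a00; have := a_gt0; lra. Qed.

Let hE x : 0 < x -> x < 1 -> H phi0 Z x Q = (h x)%:E.
Proof. by move=> x0 x1; rewrite fineK// H_fin_num. Qed.

Let oE : Lambda_outer Lambda Q = o%:E.
Proof. by rewrite fineK// Lambda_outer_fin_num. Qed.

Let o0 : 0 <= o.
Proof. by apply: fine_ge0; rewrite Lambda_outerE outer_from_ge0. Qed.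

Let C1_ge0 : 0 <= 2 / (1 - a) ^+ 2 + 2 / (a - a0) / (1 - a).
Proof.
have b0 : 0 <= 1 - a by rewrite subr_ge0 ltW.
have d0 : 0 <= a - a0 by rewrite subr_ge0 ltW.
by rewrite addr_ge0// !divr_ge0// exprn_ge0.
Qed.

Let C2_ge0 : 0 <= 2 / (a - a0).
Proof. by rewrite divr_ge0// subr_ge0 ltW. Qed.

Let K0 : 0 <= K.
Proof.
have := mulr_ge0 C1_ge0 (addr_ge0 o0 ler01).
by have := mulr_ge0_le0 C2_ge0 M0; rewrite /K; lra.
Qed.

Let c0 : 0 <= c.
Proof.
by apply: mulr_ge0; [rewrite invr_ge0 subr_ge0 ltW|exact: addr_ge0].
Qed.

Let k_ge0 : 0 <= c - M + K.
Proof. by rewrite addr_ge0// subr_ge0 (le_trans M0). Qed.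

(** The power sum at a lies between [h a] and [h a + e], which is inserted into the Taylor bound
    from above and the tangent bound from below. *)
Lemma near_optimal_cover e A : 0 < e -> e <= e1 ->
  coversH1 Lambda phi0 Z a e Q A ->
  exists L, [/\ power_log_sum phi0 Z a A = L%:E, M <= L, L <= c &
    forall x, (a0 + a) / 2 <= x -> x <= a ->
      h x <= h a + e - (a - x) * L + (a - x) ^+ 2 * K /\
      ((h a - (a - x) * L)%:E <= power_sum phi0 Z x A)%E].
Proof.
move=> e0 ee1 cA; have LMA := LM (coversH1_homo ee1 cA).
have /(coversH1E _ _ a_gt0 a1)[QA] := cA.
rewrite oE hE// -!EFinD => mA pA.
have [m [p [L [L0 [mE pE LE L0E]]]]] := cover_estimates S_bij Z_meas Z_ge0
  Z_density a00 a0a a1 QA (lt_trans mA (ltry _)) (lt_trans pA (ltry _))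
  (lt_le_trans (ltNyr M) LMA).
move=> [m0 L0L Lm est]; exists L.
rewrite mE lte_fin in mA; rewrite pE lte_fin in pA; rewrite L0E lee_fin in LMA.
have mo : m <= o + 1 by rewrite (le_trans (ltW mA))// lerD2l (le_trans ee1).
split=> //; first exact: le_trans L0L.
  apply: le_trans Lm _; rewrite ler_wpM2l// invr_ge0 subr_ge0 ltW//.
move=> x a0x xa; have [q qE /andP[pq qp]] := est x a0x xa.
have x0 : 0 < x by exact: left_gt0.
have x1 : x < 1 by exact: le_lt_trans a1.
have hq : h x <= q.
  by rewrite -lee_fin -hE// -qE; apply: ereal_inf_lbound; exists A.
have hp : h a <= p.
  by rewrite -lee_fin -hE// -pE; apply: ereal_inf_lbound; exists A.
split; last by rewrite qE lee_fin (le_trans _ pq)// lerD2r.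
have := ler_wpM2l C1_ge0 mo; have := ler_wpM2l C2_ge0 LMA => k2 k1.
have := ler_wpM2l (sqr_ge0 (a - x)) (lerB k1 k2); rewrite -/K.
by move: hq (ltW pA) qp; move: (h x) (h a) K => hx ha k *; lra.
Qed.

Lemma H_left_le x : (a0 + a) / 2 <= x -> x <= a ->
  h x <= h a - (a - x) * M + (a - x) ^+ 2 * K.
Proof.
move=> a0x xa; apply/ler_addgt0Pr => e e0.
pose e' := Num.min e e1.
have e'0 : 0 < e' by rewrite lt_min e0.
have e'e1 : e' <= e1 by rewrite ge_min lexx orbT.
have e'e : e' <= e by rewrite ge_min lexx.
have [A cA] := coversH1_nonempty a_gt0 a1 e'0.
have [L [_ ML _ /(_ x a0x xa)[hx _]]] := near_optimal_cover e'0 e'e1 cA.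
have d0 : 0 <= a - x by rewrite subr_ge0.
have := ler_wpM2l d0 ML.
by move: hx e'e; move: (h x) (h a) K => hx ha k *; lra.
Qed.

(** Passing from x to a costs (a - x) c by [power_sum_le], and replacing [h x] by [h a] costs (a -
    x) (K - M) by [H_left_le], as (a - x)^2 <= a - x. *)
Lemma coversH1_left x e : (a0 + a) / 2 <= x -> x < a -> a - x <= 1 ->
  0 < e -> e <= 1 ->
  coversH1 Lambda phi0 Z x e Q `<=`
  coversH1 Lambda phi0 Z a (e + (a - x) * (c - M + K)) Q.
Proof.
move=> a0x xa ax1 e0 e1' A.
have x0 : 0 < x by exact: left_gt0.
have x1 : x < 1 by exact: lt_trans a1.
have d0 : 0 <= a - x by rewrite subr_ge0 ltW.
move=> /(coversH1E _ _ x0 x1)[QA mA pA]; apply/coversH1E => //; split=> //.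
  apply: lt_le_trans mA _; rewrite leeD2l// lee_fin lerDl.
  exact: mulr_ge0.
have := power_sum_le S_bij Z_meas Z_ge0 Z_density x0 xa a1 QA.
have m0 : (0 <= measure_sum Lambda A)%E by exact: nneseries_ge0.
move: mA pA; rewrite oE !hE// -!EFinD.
have := power_sum_ge0 x A; case: (power_sum phi0 Z x A) => // p _.
case: (measure_sum Lambda A) m0 => // m m0; rewrite !lte_fin => mo ph.
move=> /le_lt_trans; apply; rewrite -EFinM -EFinD lte_fin.
have hx := H_left_le a0x (ltW xa).
have mc : (a - x) / (1 - a) * m <= (a - x) * c.
  rewrite -mulrA ler_wpM2l// ler_wpM2l ?invr_ge0 ?subr_ge0 ?(ltW a1)//.
  by rewrite (le_trans (ltW mo))// lerD2l.
have dd : (a - x) ^+ 2 * K <= (a - x) * K.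
  by rewrite ler_wpM2r// expr2 ler_piMl.
by move: hx ph mc dd; move: (h x) (h a) K c => hx ha k c' *; lra.
Qed.

(** The value lies between [M] and [c]; the lower bound uses that almost optimal covers exist for
    every tolerance. *)
Lemma E1_fin : exists E : R, E1 Lambda phi0 Z a a Q = E%:E.
Proof.
have subM : (M%:E <= E1 Lambda phi0 Z a a Q)%E.
  rewrite E1E; apply: le_ereal_inf_tmp => _ [e e0 <-].
  pose e' := Num.min e e1.
  have e'0 : 0 < e' by rewrite lt_min e0.
  have e'e1 : e' <= e1 by rewrite ge_min lexx orbT.
  have [A cA] := coversH1_nonempty a_gt0 a1 e'0.
  have [L [LE ML _ _]] := near_optimal_cover e'0 e'e1 cA.
  apply: (@le_trans _ _ L%:E); first by rewrite lee_fin.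
  rewrite -LE; apply: sup_log_ub; apply: coversH1_homo cA.
  by rewrite ge_min lexx.
have supc : (E1 Lambda phi0 Z a a Q <= c%:E)%E.
  apply: le_trans (E1_le _ _ e10) _; apply: ge_ereal_sup => _ [A cA <-].
  have [L [-> _ Lc _]] := near_optimal_cover e10 (lexx _) cA.
  by rewrite lee_fin.
exists (fine (E1 Lambda phi0 Z a a Q)); rewrite fineK//.
by rewrite fin_numE gt_eqF ?lt_eqF//;
  [exact: le_lt_trans supc (ltry _)|exact: lt_le_trans (ltNyr _) subM].
Qed.

Let slope x := (h a - h x) / (a - x).

(** The Taylor bound is solved for L, followed by the supremum over covers and e -> 0. *)
Lemma E1_le_slope E x : E1 Lambda phi0 Z a a Q = E%:E ->
  (a0 + a) / 2 <= x -> x < a -> E - (a - x) * K <= slope x.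
Proof.
move=> EE a0x xa; have d0 : 0 < a - x by rewrite subr_gt0.
rewrite ler_pdivlMr//; apply/ler_addgt0Pr => e e0.
pose e' := Num.min e e1.
have e'0 : 0 < e' by rewrite lt_min e0.
have e'e1 : e' <= e1 by rewrite ge_min lexx orbT.
have e'e : e' <= e by rewrite ge_min lexx.
suff : (E%:E <= ((h a - h x + e' + (a - x) ^+ 2 * K) / (a - x))%:E)%E.
  rewrite lee_fin ler_pdivlMr//.
  by move: e'e; move: (h x) (h a) K (e') => hx ha k r *; lra.
rewrite -EE; apply: le_trans (E1_le _ _ e'0) _.
apply: ge_ereal_sup => _ [A cA <-].
have [L [-> _ _ /(_ x a0x (ltW xa))[hx _]]] := near_optimal_cover e'0 e'e1 cA.
rewrite lee_fin ler_pdivlMr//; move: hx.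
by move: (h x) (h a) K (e') => hx ha k r; lra.
Qed.

(** For a cover e'-optimal at x, the tangent bound gives h(a) - (a - x) L < h(x) + e', so the slope
    is below L + e' / (a - x). *)
Lemma slope_le_E1 x : (a0 + a) / 2 <= x -> x < a -> a - x <= 1 ->
  (a - x) * (c - M + K) < e1 ->
  ((slope x)%:E <= E1 Lambda phi0 Z a x Q)%E.
Proof.
move=> a0x xa ax1 kx; have d0 : 0 < a - x by rewrite subr_gt0.
have x0 : 0 < x by exact: left_gt0.
have x1 : x < 1 by exact: lt_trans a1.
rewrite E1E; apply: le_ereal_inf_tmp => _ [e e0 <-].
apply/lee_addgt0Pr => r r0.
set k := (a - x) * (c - M + K) in kx *.
(* In turn: to stay among the given covers, to have tolerance at most [e1] after the passage to a,
   to allow that passage, and to make e' / (a - x) at most r. *)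
pose e' := Num.min (Num.min e (e1 - k)) (Num.min 1 (r * (a - x))).
have e'0 : 0 < e'.
  by rewrite !lt_min e0 ltr01 subr_gt0 kx/= mulr_gt0.
have e'e : e' <= e by rewrite !ge_min lexx.
have e'k : e' + k <= e1 by rewrite -lerBrDr !ge_min lexx orbT.
have e'1 : e' <= 1 by rewrite !ge_min lexx !orbT.
have e'r : e' <= r * (a - x) by rewrite !ge_min lexx !orbT.
have k0 : 0 <= k.
  by apply: mulr_ge0; [exact: ltW|exact: k_ge0].
have [A cA] := coversH1_nonempty x0 x1 e'0.
have cA' := coversH1_left a0x xa ax1 e'0 e'1 cA.
have [|L [LE _ _ /(_ x a0x (ltW xa))[_ hp]]] := near_optimal_cover _ e'k cA'.
  by rewrite ltr_wpDr.
apply: (@le_trans _ _ (L + r)%:E); last first.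
  rewrite EFinD leeD2r// -LE; apply: sup_log_ub; exact: coversH1_homo cA.
have /(coversH1E _ _ x0 x1)[_ _ pA] := cA.
have := le_lt_trans hp pA; rewrite hE// -EFinD lte_fin => hh.
rewrite lee_fin ler_pdivrMr//; move: hh e'r.
by move: (h x) (h a) (e') => hx ha s *; lra.
Qed.

(** The tolerance a - x is used at x; after the passage to a it still tends to 0 with a - x. *)
Lemma E1_le_sup_log x : (a0 + a) / 2 <= x -> x < a -> a - x <= 1 ->
  (E1 Lambda phi0 Z a x Q <= sup_log a a ((a - x) * (1 + (c - M + K))))%E.
Proof.
move=> a0x xa ax1; have d0 : 0 < a - x by rewrite subr_gt0.
apply: le_trans (E1_le _ _ d0) _; apply: ge_ereal_sup => _ [A cA <-].
apply: sup_log_ub; rewrite mulrDr mulr1.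
exact: coversH1_left cA.
Qed.

Lemma left_derivative_H : exists l : R,
  [/\ is_left_derivative (fun x => H phi0 Z x Q) a l,
    E1 Lambda phi0 Z a a Q = l%:E &
    E1 Lambda phi0 Z a x Q @[x --> a^'-] --> l%:E].
Proof.
have [E EE] := E1_fin; exists E.
have kk : 0 < 1 + (c - M + K) by rewrite ltr_pwDl.
(* Both limits are read off from this one chain of inequalities. *)
have key e : 0 < e -> \forall x \near a^'-,
    [/\ 0 < x, x < a, E - e <= slope x,
    ((slope x)%:E <= E1 Lambda phi0 Z a x Q)%E &
    (E1 Lambda phi0 Z a x Q <= (E + e)%:E)%E].
  move=> e0.
  have [e2 e20 supE] : exists2 e2, 0 < e2 & (sup_log a a e2 < (E + e)%:E)%E.
    have : (E1 Lambda phi0 Z a a Q < (E + e)%:E)%E by rewrite EE lte_fin ltrDl.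
    by rewrite E1E => /ereal_inf_lt[_ [e2 e20 <-]] ?; exists e2.
  near=> x.
  have xa : x < a by near: x; exact: nbhs_left_lt.
  have a0x : (a0 + a) / 2 <= x.
    by near: x; apply: nbhs_left_ge; have := a0a; lra.
  have ax1 : a - x <= 1.
    by apply: ltW; near: x; exact: nbhs_left_ltBl.
  have axe1 : (a - x) * (1 + (c - M + K)) < e1.
    rewrite -ltr_pdivlMr//; near: x; apply: nbhs_left_ltBl.
    by rewrite divr_gt0.
  have axe2 : (a - x) * (1 + (c - M + K)) < e2.
    rewrite -ltr_pdivlMr//; near: x; apply: nbhs_left_ltBl.
    by rewrite divr_gt0.
  (* [1 + K] replaces [K] to have a positive divisor. *)
  have axe : (a - x) * (1 + K) < e.
    rewrite -ltr_pdivlMr; last by rewrite ltr_pwDl.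
    near: x; apply: nbhs_left_ltBl.
    by rewrite divr_gt0// ltr_pwDl.
  have d0 : 0 < a - x by rewrite subr_gt0.
  split; [exact: left_gt0|by []| | |].
  - have := E1_le_slope EE a0x xa; apply: le_trans; rewrite lerD2l lerN2.
    by rewrite (le_trans _ (ltW axe))// ler_wpM2l ?(ltW d0)// lerDr.
  - apply: slope_le_E1 => //; apply: le_lt_trans axe1.
    by rewrite ler_wpM2l ?(ltW d0)// lerDr.
  - apply: le_trans (E1_le_sup_log a0x xa ax1) _; apply: le_trans (ltW supE).
    by apply: sup_log_homo; exact: ltW.
split=> //; apply: cvge_fin_near => e /key; apply: filterS => x.
- move=> [x0 xa Es sE EeE]; have x1 : x < 1 by exact: lt_trans a1.
  have d0 : 0 < a - x by rewrite subr_gt0.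
  rewrite !hE// -EFinB -EFinM.
  have -> : (h x - h a) * (x - a)^-1 = slope x.
    by rewrite /slope -opprB -(opprB a x) invrN mulrNN.
  by rewrite !lee_fin Es/= -lee_fin; exact: le_trans sE EeE.
- by move=> [_ _ Es sE ->]; rewrite andbT; apply: le_trans sE; rewrite lee_fin.
Unshelve. all: by end_near. Qed.

End estimates.

End left_derivative.
Theorem theorem4 (R : realType) (d : measure_display) (X : measurableType d)
    (S : X -> X) (S_bij : bijective S)
    (phi0 Lambda : {finite_measure set (forward_type S) -> \bar R})
    (Lambda_inv : forall A : set (forward_type S),
      measurable A -> Lambda (S @^-1` A) = Lambda A)
    (Lambda_ac : Lambda `<< phi0)
    (Z : forward_type S -> \bar R)
    (Z_meas : measurable_fun [set: forward_type S] Z)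
    (Z_ge0 : forall x, (0 <= Z x)%E)
    (Z_density : forall A : set (forward_type S),
      measurable A -> Lambda A = (\int[phi0]_(z in A) Z z)%E)
    (Q : set X) (Q_meas : <<s two_sided_sets S >> Q)
    (alpha : R) (alpha_gt0 : 0 < alpha) (alpha_lt1 : alpha < 1)
    (D1_gtNy : exists alpha0 : R, [/\ 0 < alpha0, alpha0 < alpha &
      (-oo < D1 Lambda phi0 Z alpha0 alpha Q)%E]) :
  exists l : R,
    [/\ is_left_derivative (fun x => H phi0 Z x Q) alpha l,
        E1 Lambda phi0 Z alpha alpha Q = l%:E &
        E1 Lambda phi0 Z alpha x Q @[x --> alpha^'-] --> l%:E].
Proof.
have [a0 [a00 a0a /D1_lower_bound[M [e [e0 LM]]]]] := D1_gtNy.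
(* The lower bound survives a smaller tolerance and a smaller constant; tolerance at most 1 gives
   the mass bound [o + 1], and a constant at most 0 makes [K] nonnegative. *)
have e10 : 0 < Num.min e 1 by rewrite lt_min e0 ltr01.
have e11 : Num.min e 1 <= 1 by rewrite ge_min lexx orbT.
have M0 : Num.min M 0 <= 0 by rewrite ge_min lexx orbT.
refine (left_derivative_H S_bij Lambda_inv Z_meas Z_ge0 Z_density Q_meas
  a00 a0a alpha_lt1 e10 e11 M0 _) => A cA.
apply: (@le_trans _ _ M%:E); first by rewrite lee_fin ge_min lexx.
by apply: LM; apply: coversH1_homo cA; rewrite ge_min lexx.
Qed.
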